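(* Let $(\mathcal{X},d)$ be a Polish metric space and let $(X_N)_{N\in\mathbb{N}}$ be a Markov chain on $\mathcal{X}$ with transition kernel $(P_x)_{x\in\mathcal{X}}$, where $x\mapsto P_x$ is measurable and each $P_x$ has finite first moment. Assume there exists $\kappa>0$ such that $W_1(P_x,P_y)\le(1-\kappa)\,d(x,y)$ for all $x,y$, that $\sigma_\infty<\infty$, and let $\pi$ be the invariant probability measure. Assume there is a Lipschitz $S:\mathcal{X}\to\mathbb{R}$ with $\|S\|_{\mathrm{Lip}}\le C$ and $\frac{\sigma(x)^2}{n_x\kappa}\le S(x)$ for all $x$. Let $T\ge1$, $T_0\ge0$ be integers, $\hat\pi(f):=\frac1T\sum_{k=T_0+1}^{T_0+T}f(X_k)$, and for $x\in\mathcal{X}$ let \[ V_x^2:=\frac{1}{\kappa T}\Big(1+\frac{T_0}{T}\Big)\mathbb{E}_\pi S+\frac{C\,E(x)}{\kappa^2T^2},\qquad r_{\max}:=\frac{4V_x^2\kappa T}{\max\{2C,3\sigma_\infty\}}. \] Then for every non-constant Lipschitz $f:\mathcal{X}\to\mathbb{R}$, every $x\in\mathcal{X}$ and every $r>0$, \[ \mathbb{P}_x\Big(\frac{|\hat\pi(f)-\mathbb{E}_x\hat\pi(f)|}{\|f\|_{\mathrm{Lip}}}\ge r\Big)\le \begin{cases} 2e^{-r^2/(16V_x^2)}, & r\in(0,r_{\max}),\\ 2e^{-\kappa Tr/(4\max\{2C,3\sigma_\infty\})}, & r\ge r_{\max}. \end{cases} \]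
   Context: $W_1$ is the $L^1$ Wasserstein distance. $\mathbb{P}_x,\mathbb{E}_x$ refer to the chain started at $X_0=x$. $E(x):=\int d(x,y)\,\pi(dy)$. $\sigma_\infty:=\frac12\sup_x\operatorname{diam}\operatorname{Supp}P_x$. $\sigma(x)^2:=\frac12\iint d(y,z)^2P_x(dy)P_x(dz)$; $n_x:=\inf\{\iint d(y,z)^2P_x(dy)P_x(dz)/\iint|g(y)-g(z)|^2P_x(dy)P_x(dz): g\ 1\text{-Lipschitz}\}$. $\|f\|_{\mathrm{Lip}}:=\sup_{x\ne y}|f(x)-f(y)|/d(x,y)$. *)

(* Defs.v *)
From HB Require Import structures.
From mathcomp Require Import all_boot all_order all_algebra.
From mathcomp Require Import all_classical all_reals all_analysis measurable_realfun.
Set Implicit Arguments. Unset Strict Implicit. Unset Printing Implicit Defensive.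
Import Order.TTheory GRing.Theory Num.Theory.
Local Open Scope classical_set_scope.
Local Open Scope ring_scope.

Section MetricMarkov.
Variables (R : realType) (dT : measure_display) (T : measurableType dT).
Variable (dist : T -> T -> R).

Definition is_metric : Prop :=
  (forall x y, 0 <= dist x y) /\ (forall x y, dist x y = 0 <-> x = y) /\
  (forall x y, dist x y = dist y x) /\
  (forall x y z, dist x z <= dist x y + dist y z).

Definition dball (x : T) (e : R) : set T := [set y | dist x y < e].

Definition dopen (A : set T) : Prop :=
  forall x, A x -> exists2 e : R, 0 < e & dball x e `<=` A.

Definition is_polish : Prop :=
  (exists D : set T, countable D /\
     forall x (e : R), 0 < e -> exists2 y, D y & dist x y < e) /\
  (forall u : nat -> T,
     (forall e : R, 0 < e -> exists N, forall m n, (N <= m)%N -> (N <= n)%N ->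
        dist (u m) (u n) < e) ->
     exists l, forall e : R, 0 < e -> exists N, forall n, (N <= n)%N -> dist (u n) l < e).

Definition borel_of : Prop :=
  forall A : set T, measurable A <-> <<s [set B | dopen B] >> A.

Definition dlipnorm (f : T -> R) : \bar R :=
  ereal_sup [set r | exists x y, x <> y /\ r = (`|f x - f y| / dist x y)%:E].

Definition dlipschitz (f : T -> R) : Prop :=
  exists c : R, forall x y, `|f x - f y| <= c * dist x y.

Definition is_coupling (mu nu : probability T R) (g : probability (T * T)%type R) : Prop :=
  forall A : set T, measurable A -> g (A `*` setT) = mu A /\ g (setT `*` A) = nu A.

Definition W1 (mu nu : probability T R) : \bar R :=
  ereal_inf [set (\int[g]_z (dist z.1 z.2)%:E)%E | g in [set g | is_coupling mu nu g]].

Definition msupp (mu : probability T R) : set T :=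
  [set y | forall e : R, 0 < e -> (0 < mu (dball y e))%E].

Definition ddiam (A : set T) : \bar R :=
  ereal_sup [set r | exists y z, A y /\ A z /\ r = (dist y z)%:E].

Variable P : T -> probability T R.

Definition sigma_inf : \bar R :=
  ((2^-1)%:E * ereal_sup [set ddiam (msupp (P x)) | x in [set: T]])%E.

Definition sigma2 (x : T) : \bar R :=
  ((2^-1)%:E * \int[P x]_y \int[P x]_z ((dist y z) ^+ 2)%:E)%E.

(* local dimension n_x (a ratio with zero denominator counts as +oo) *)
Definition n_loc (x : T) : \bar R :=
  ereal_inf [set ((\int[P x]_y \int[P x]_z ((dist y z) ^+ 2)%:E) *
                  (\int[P x]_y \int[P x]_z ((g y - g z) ^+ 2)%:E)^-1)%E
            | g in [set g : T -> R | forall y z, `|g y - g z| <= dist y z]].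

Definition invariant_prob (pi : probability T R) : Prop :=
  forall A : set T, measurable A -> (\int[pi]_y P y A = pi A)%E.

Definition Emean (pi : probability T R) (x : T) : R := Rintegral pi setT (fun y => dist x y).

Definition markov_chain_from (dO : measure_display) (Omega : measurableType dO)
  (Pr : probability Omega R) (X : nat -> Omega -> T) (x : T) : Prop :=
  (forall n, measurable_fun setT (X n)) /\
  Pr (X 0%N @^-1` [set x]) = 1%E /\
  (forall (n : nat) (A : nat -> set T), (forall i, measurable (A i)) ->
     Pr [set w | forall i, (i <= n.+1)%N -> A i (X i w)] =
     (\int[Pr]_(w in [set w | forall i, (i <= n)%N -> A i (X i w)]) P (X n w) (A n.+1))%E).

End MetricMarkov.

Definition pihat (R : realType) (T Omega : Type) (X : nat -> Omega -> T)
  (Tn T0 : nat) (f : T -> R) (w : Omega) : R :=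
  (Tn%:R)^-1 * \sum_(T0.+1 <= k < T0.+1 + Tn) f (X k w).

(* Main.v *)
(* Write N = T0 + T and u_k = 1 for T0 < k <= N, u_k = 0 otherwise, so that T * pihat(f) is the sum
   of u_k f(X_k) over k <= N; take f to be 1-Lipschitz. If h is a-Lipschitz and 3 l a sigma_inf <= 1,
   then e^t <= 1 + t + t^2 for t <= 2/3 gives P(e^(l h)) <= e^(l P h + l^2 a^2 kappa S), because
   Var_(P_x)(h) <= a^2 sigma(x)^2 / n_x. Integrating out X_N, X_(N-1), ... one at a time replaces
   the last function h by u_n f + P h + l a^2 kappa S, which stays (2/kappa)-Lipschitz as long as
   4 l C <= kappa, by the contraction of W1 under P. Without the S terms the recursion ends in
   E_x[T * pihat(f)]; the S terms contribute (4 l / kappa) B_N(x) with B_(k+1) = S + P B_k. As B_N is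
   (C/kappa)-Lipschitz with mean N E_pi S under pi, B_N(x) <= N E_pi S + (C/kappa) E(x).
   The theorem is then the exponential Markov inequality with the best admissible l. *)
Require Import Defs.
From HB Require Import structures.
From mathcomp Require Import all_boot all_order all_algebra.
From mathcomp Require Import all_classical all_reals all_analysis measurable_realfun.
From mathcomp Require Import ring lra.
Import Order.TTheory GRing.Theory Num.Theory.
Local Open Scope classical_set_scope.
Local Open Scope ring_scope.

(** The slope [2 / kappa]: without the S terms the slopes would settle at the solution [1 / kappa]
    of [a = 1 + (1 - kappa) a]; doubling it leaves room exactly 1 for the slope
    [l a^2 kappa C = 4 l C / kappa] of one S term. With [l / T] in place of [l], this condition and
    [3 (l / T) (2 / kappa) sigma_inf <= 1] merge into [2 l M <= kappa T], where
    [M = max (2 C) (3 sigma_inf)]; [r_max] is the value of r beyond which the minimiser of the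
    exponent violates it. Two measure-theoretic gaps shape the rest. The chain is known only through
    probabilities of events that constrain each coordinate separately, and pi only through measures
    of sets, while the recursion needs integrals of functions. As the weights that occur are
    products of functions of single coordinates, it suffices to replace indicators by functions one
    coordinate at a time. Moreover invariance of pi carries no first moment with it, so [E(x)] and
    the mean of S under pi must first be shown to be genuine finite integrals. *)

(** * Mixtures of measures, and passing from sets to nonnegative functions *)

Section Mixture.
Local Open Scope ereal_scope.
Context {R : realType}.
Import HBNNSimple.

(** The integral of a nonnegative function is a supremum over the simple functions below it, so
    monotonicity needs no measurability. This matters for iterated integrals such as that of
    [(dist y z) ^+ 2], whose inner integral is never shown to be measurable in [y]. *)
Lemma ge0_le_integralT {d} {T : measurableType d} (mu : {measure set T -> \bar R})
  (f g : T -> \bar R) : (forall x, 0 <= f x) -> (forall x, f x <= g x) ->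
  \int[mu]_x f x <= \int[mu]_x g x.
Proof.
move=> f0 fg; rewrite !ge0_integralTE//; last by move=> x; exact: le_trans (fg x).
by apply: le_ereal_sup => _ [h hf <-]; exists h => // x; exact: le_trans (hf x) _.
Qed.

(** This is the integral of [h] against the mixture that sends [A] to the integral of [W w * k w A],
    written without constructing that measure. With [k] a Dirac mass or the kernel [P], both sides
    of the Markov property and of invariance take this form. *)
Definition mixint {d d'} {Om : measurableType d} {T : measurableType d'}
  (mu : {measure set Om -> \bar R}) (W : Om -> \bar R)
  (k : Om -> {measure set T -> \bar R}) (h : T -> \bar R) : \bar R :=
  \int[mu]_w (W w * \int[k w]_z h z).

Section One.
Context {d d'} {Om : measurableType d} {T : measurableType d'}.
Variables (mu : {measure set Om -> \bar R}) (W : Om -> \bar R)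
  (k : Om -> {measure set T -> \bar R}).
Hypothesis W0 : forall w, 0 <= W w.
Hypothesis Wfin : forall w, W w \is a fin_num.
Hypothesis mW : measurable_fun setT W.
Hypothesis mk : forall A, measurable A -> measurable_fun setT (k ^~ A).

Let mint h : (forall z, 0 <= h z) -> measurable_fun setT h ->
  measurable_fun setT (fun w => \int[k w]_z h z).
Proof. by move=> h0 mh; apply: measurable_fun_integral_kernel. Qed.

Lemma mixint_nnsfun (f : {nnsfun T >-> R}) :
  mixint mu W k (EFin \o f) =
  \sum_(r \in range f) r%:E * \int[mu]_w (W w * k w (f @^-1` [set r])).
Proof.
have E w : \int[k w]_z (f z)%:E =
    \sum_(r \in range f) r%:E * k w (f @^-1` [set r]).
  by rewrite integralT_nnsfun sintegralE.
have F0 (r : R) w : 0 <= r%:E * k w (f @^-1` [set r]).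
  by apply: (mulemu_ge0 (fun n => f @^-1` [set n])); exact: preimage_nnfun0.
rewrite /mixint; under eq_integral => w _ do
  (rewrite /= E ge0_mule_fsumr; last by move=> r; exact: F0).
rewrite ge0_integral_fsum//=; last 2 first.
- move=> r; apply: emeasurable_funM => //; apply: measurable_funeM.
  exact: mk.
- by move=> r w _; rewrite mule_ge0.
(* Only values of [f] occur in the sum, so [r] is nonnegative, as pulling it out of the integral
   requires. *)
apply: eq_fsbigr => r /[!inE] -[t _ <-].
have ft : 0 <= (f t)%:E by rewrite lee_fin.
rewrite -ge0_integralZl//; last 2 first.
- by apply: emeasurable_funM => //; exact: mk.
- by move=> w _; rewrite mule_ge0.
by apply: eq_integral => w _; rewrite muleCA.
Qed.

(** Monotone convergence is applied twice: under each [k w], then under [mu]. Finiteness of [W w]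
    lets the inner limit pass through the product. *)
Lemma mixint_cvg (g : nat -> T -> \bar R) (h : T -> \bar R) :
  (forall n, measurable_fun setT (g n)) -> (forall n z, 0 <= g n z) ->
  (forall z, nondecreasing_seq (g ^~ z)) -> (forall z, g ^~ z @ \oo --> h z) ->
  mixint mu W k (g n) @[n --> \oo] --> mixint mu W k h.
Proof.
move=> mg g0 ndg gh.
have ndi w : nondecreasing_seq (fun n => \int[k w]_z g n z).
  by move=> m n mn; apply: ge0_le_integral => // z _; exact: ndg.
have hE w : \int[k w]_z g n z @[n --> \oo] --> \int[k w]_z h z.
  rewrite (_ : h = fun z => limn (g ^~ z)); last first.
    by apply/funext => z; apply/esym/cvg_lim => //; exact: gh.
  by apply: (@cvg_monotone_convergence _ _ _ (k w) setT measurableT g) => // z _; exact: ndg.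
have -> : mixint mu W k h = \int[mu]_w limn (fun n => W w * \int[k w]_z g n z).
  apply: eq_integral => w _; apply/esym/cvg_lim => //.
  apply: cvgeZl => //.
apply: (@cvg_monotone_convergence _ _ _ mu setT measurableT
  (fun n w => W w * \int[k w]_z g n z)) => //.
- by move=> n; apply: emeasurable_funM => //; exact: mint.
- by move=> n w _; rewrite mule_ge0// integral_ge0.
- by move=> w _ m n mn; rewrite lee_wpmul2l// ndi.
Qed.

End One.

(** Two mixtures that agree on measurable sets agree on simple functions by linearity, hence on all
    nonnegative measurable functions by increasing approximation. *)
Lemma eq_mixint {d1 d2 d'} {O1 : measurableType d1} {O2 : measurableType d2}
  {T : measurableType d'}
  (mu1 : {measure set O1 -> \bar R}) (W1 : O1 -> \bar R) (k1 : O1 -> {measure set T -> \bar R})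
  (mu2 : {measure set O2 -> \bar R}) (W2 : O2 -> \bar R) (k2 : O2 -> {measure set T -> \bar R}) :
  (forall w, 0 <= W1 w) -> (forall w, W1 w \is a fin_num) -> measurable_fun setT W1 ->
  (forall A, measurable A -> measurable_fun setT (k1 ^~ A)) ->
  (forall w, 0 <= W2 w) -> (forall w, W2 w \is a fin_num) -> measurable_fun setT W2 ->
  (forall A, measurable A -> measurable_fun setT (k2 ^~ A)) ->
  (forall A, measurable A ->
    \int[mu1]_w (W1 w * k1 w A) = \int[mu2]_w (W2 w * k2 w A)) ->
  forall h : T -> \bar R, (forall z, 0 <= h z) -> measurable_fun setT h ->
  mixint mu1 W1 k1 h = mixint mu2 W2 k2 h.
Proof.
move=> W10 fW1 mW1 mk1 W20 fW2 mW2 mk2 E h h0 mh.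
pose g := nnsfun_approx measurableT mh.
have mg n : measurable_fun setT (EFin \o g n) by exact/measurable_EFinP.
have g0 n z : 0 <= (EFin \o g n) z by rewrite lee_fin.
have ndg z : nondecreasing_seq (fun n => (EFin \o g n) z).
  by move=> m n mn; rewrite lee_fin; exact/lefP/nd_nnsfun_approx.
have gh z : (fun n => (EFin \o g n) z) @ \oo --> h z.
  exact: (@cvg_nnsfun_approx _ _ _ _ _ h).
have c1 := mixint_cvg mu1 W1 k1 W10 fW1 mW1 mk1 _ _ mg g0 ndg gh.
have c2 := mixint_cvg mu2 W2 k2 W20 fW2 mW2 mk2 _ _ mg g0 ndg gh.
have EE n : mixint mu1 W1 k1 (EFin \o g n) = mixint mu2 W2 k2 (EFin \o g n).
  by rewrite !mixint_nnsfun//; apply: eq_fsbigr => r _; rewrite E.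
by rewrite -(cvg_lim _ c1)// -(cvg_lim _ c2)//; congr (limn _); apply/funext => n.
Qed.

End Mixture.

(** * Lipschitz functions and supports in a separable metric space *)

Section Metric.
Context {R : realType} {dT : measure_display} {T : measurableType dT}.
Variable dist : T -> T -> R.

Definition lip_with (c : R) (h : T -> R) := forall y z, `|h y - h z| <= c * dist y z.

Hypothesis Hmetric : is_metric dist.
Hypothesis Hborel : borel_of dist.

Lemma metric_ge0 y z : 0 <= dist y z. Proof. by case: Hmetric. Qed.
Lemma metricC y z : dist y z = dist z y.
Proof. by case: Hmetric => _ [_ []]. Qed.
Lemma metric_triangle y z t : dist y t <= dist y z + dist z t.
Proof. by case: Hmetric => _ [_ []]. Qed.
Lemma metric_eq0 y z : dist y z = 0 <-> y = z.
Proof. by case: Hmetric => _ []. Qed.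
Lemma metric_refl y : dist y y = 0. Proof. exact/metric_eq0. Qed.

Lemma dopen_measurable A : dopen dist A -> measurable A.
Proof. by move=> oA; apply/Hborel => M [_]; exact. Qed.

Lemma lip_with_measurable c h : lip_with c h -> measurable_fun setT h.
Proof.
move=> hc; apply: (measurability _ (RGenOInfty.measurableE R)) => _ [_ [r ->] <-].
rewrite setTI; apply: dopen_measurable => y /=; rewrite in_itv/= andbT => ry.
(* Superlevel sets are shown to be open; the denominator [|c| + 1] gives a legitimate radius even
   when [c] is zero or negative. *)
have c1 : 0 < `|c| + 1 by rewrite ltr_wpDl.
exists ((h y - r) / (`|c| + 1)); first by rewrite divr_gt0// subr_gt0.
move=> z; rewrite /dball/= in_itv/= andbT ltr_pdivlMr// => zy.
have /ler_normlP[_ H] := hc y z.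
rewrite -subr_gt0; apply: lt_le_trans (_ : h y - r - c * dist y z <= _); last lra.
have := ler_norm c; have := metric_ge0 y z; nra.
Qed.

Lemma lip_with_dist y : lip_with 1 (dist y).
Proof.
move=> z t; rewrite mul1r ler_norml; apply/andP; split.
  by have := metric_triangle y z t; lra.
by have := metric_triangle y t z; rewrite (metricC t z); lra.
Qed.

Lemma measurable_set1_metric (y : T) : measurable ([set y] : set T).
Proof.
have := lip_with_measurable 1 (dist y) (lip_with_dist y) measurableT [set 0].
move=> /(_ (measurable_set1 0)); rewrite setTI.
rewrite (_ : _ @^-1` _ = [set y])//.
by apply/seteqP; split=> z /=; [move/metric_eq0|move->; rewrite metric_refl].
Qed.

Lemma dball_measurable (y : T) e : measurable (dball dist y e).
Proof.
apply: dopen_measurable => z /= yz; exists (e - dist y z); first by rewrite subr_gt0.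
by move=> t; rewrite /dball/= => zt; have := metric_triangle y z t; lra.
Qed.

(** By separability, each point outside the support lies in a null ball with centre in [D] and
    radius [1 / (n + 1)], and there are countably many such balls. *)
Lemma negligible_setC_msupp (mu : probability T R) :
  is_polish dist -> mu.-negligible (~` msupp dist mu).
Proof.
move=> [[D [cD dD]] _].
have [f fD] : exists f : T -> nat, {in D &, injective f}.
  by move/countable_injP : cD => [f fD]; exists f.
(* A centre is coded by the number [k = f d], so that the union runs over natural numbers;
   injectivity of [f] on [D] then makes each [F k n] empty or a single null ball. *)
pose F (k n : nat) := [set y | exists d, [/\ D d, f d = k,
  mu (dball dist d n.+1%:R^-1) = 0%E & dball dist d n.+1%:R^-1 y]].
apply: (@negligibleS _ _ _ mu (\bigcup_k \bigcup_n F k n)).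
  move=> y /existsNP[e /not_implyP[e0 /negP]].
  rewrite -leNgt measure_le0 => /eqP ye.
  have [n n2] : exists n : nat, n.+1%:R^-1 < e / 2.
    exists (Num.truncn (e / 2)^-1); rewrite invf_plt ?posrE ?divr_gt0//.
    exact: truncnS_gt.
  have n0 : 0 < n.+1%:R^-1 :> R by rewrite invr_gt0.
  have [d Dd yd] := dD y _ n0.
  exists (f d) => //; exists n => //; exists d; split => //; last by rewrite /dball/= metricC.
  apply/eqP; rewrite -measure_le0 -ye le_measure ?inE; [|exact: dball_measurable..|].
    by [].
  move=> z; rewrite /dball/= => dz.
  apply: le_lt_trans (metric_triangle y d z) _.
  by rewrite (splitr e) ltrD // (lt_trans _ n2).
apply: negligible_bigcup => k; apply: negligible_bigcup => n.
have [[d [Dd fd d0]]|nd] := pselect (exists d, [/\ D d, f d = k &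
  mu (dball dist d n.+1%:R^-1) = 0%E]).
  exists (dball dist d n.+1%:R^-1); split => //; first exact: dball_measurable.
  move=> y [d' [Dd' fd' _ d'y]]; rewrite (fD d d')// ?inE//; first by rewrite fd.
apply: (@negligibleS _ _ _ mu set0); last exact: negligible_set0.
by move=> y [d [? ? ? _]]; apply: nd; exists d.
Qed.

End Metric.

(** * Integrals of Lipschitz functions and the Wasserstein distance *)

Section LipschitzIntegral.
Context {R : realType} {dT : measure_display} {T : measurableType dT}.
Variable dist : T -> T -> R.
Hypothesis Hmetric : is_metric dist.
Hypothesis Hborel : borel_of dist.
Local Notation lip := (lip_with dist).

Definition first_moment (mu : probability T R) :=
  exists y, (\int[mu]_z (dist y z)%:E < +oo)%E.

Lemma lip_with_integrable (mu : probability T R) c h :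
  first_moment mu -> lip c h -> mu.-integrable setT (EFin \o h).
Proof.
move=> [y ym] hc.
have mh := lip_with_measurable _ Hmetric Hborel _ _ hc.
have md := lip_with_measurable _ Hmetric Hborel _ _ (lip_with_dist _ Hmetric y).
have id : mu.-integrable setT (EFin \o dist y).
  apply/integrableP; split; first exact/measurable_EFinP.
  apply: le_lt_trans ym; apply: ge0_le_integralT => // z.
  by rewrite /= ger0_norm// (metric_ge0 _ Hmetric).
apply: (@le_integrable _ _ _ _ setT measurableT _
    ((EFin \o cst `|h y|%R) \+ (fun z => `|c|%R%:E * (EFin \o dist y) z)))%E.
- exact/measurable_EFinP.
- move=> z _; rewrite /= lee_fin [leRHS]ger0_norm; last first.
    by rewrite addr_ge0// mulr_ge0// (metric_ge0 _ Hmetric).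
  have := hc y z; have := metric_ge0 _ Hmetric y z.
  have := ler_norm c; move: `|c| => c' cc' d0 H.
  have : c * dist y z <= c' * dist y z by rewrite ler_wpM2r.
  by have := ler_distD (h y) (h z) 0; rewrite !subr0 (distrC (h z)); lra.
- apply: integrableD => //; first exact: finite_measure_integrable_cst.
  exact: integrableZl.
Qed.

Let integral_marginal (mu : probability T R) (g : probability (T * T)%type R)
  (p : T * T -> T) c h : measurable_fun setT p ->
  (forall A, measurable A -> g (p @^-1` A) = mu A) -> first_moment mu -> lip c h ->
  g.-integrable setT (EFin \o (h \o p)) /\
  Rintegral g setT (h \o p) = Rintegral mu setT h.
Proof.
move=> mp gp mm hc.
have /integrableP[mh ih] := lip_with_integrable _ _ _ mm hc.
have E f : (\int[pushforward g p]_z f z = \int[mu]_z f z)%E.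
  by apply: eq_measure_integral => A mA _; exact: gp.
have ig : g.-integrable setT ((EFin \o h) \o p).
  apply/integrableP; split; first exact: measurableT_comp.
  apply: le_lt_trans ih; rewrite -E ge0_integral_pushforward//.
  exact: measurableT_comp.
split=> //.
rewrite /Rintegral -(E (EFin \o h)); congr fine.
by rewrite (integral_pushforward mp).
Qed.

(** The easy half of Kantorovich duality: for any coupling [g], the difference of the means is the
    [g]-integral of [h z.1 - h z.2], which is at most [dist z.1 z.2] in absolute value. *)
Lemma lip_with_W1 (mu nu : probability T R) h : first_moment mu -> first_moment nu ->
  lip 1 h -> (`|Rintegral mu setT h - Rintegral nu setT h|%:E <= W1 dist mu nu)%E.
Proof.
move=> mmu mnu h1; apply: le_ereal_inf_tmp => _ [g gc <-].
have g1 A : measurable A -> g (fst @^-1` A) = mu A.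
  by move=> mA; rewrite -(gc A mA).1; congr (g _); apply/seteqP; split => -[y z]//= [].
have g2 A : measurable A -> g (snd @^-1` A) = nu A.
  by move=> mA; rewrite -(gc A mA).2; congr (g _); apply/seteqP; split => -[y z]//= [].
have [i1 <-] := integral_marginal mu g fst 1 h measurable_fst g1 mmu h1.
have [i2 <-] := integral_marginal nu g snd 1 h measurable_snd g2 mnu h1.
have iB : g.-integrable setT (EFin \o (fun z => h z.1 - h z.2)).
  exact: (integrableB measurableT i1 i2).
rewrite -RintegralB// EFin_normr_Rintegral//.
apply: le_trans (le_abse_integral _ _ _) _ => //; first by case/integrableP: iB.
apply: ge0_le_integralT => // -[y z]; rewrite lee_fin.
by have := h1 y z; rewrite mul1r.
Qed.

Lemma Rintegral_lip_with_contract (mu nu : probability T R) c h k :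
  0 <= c -> first_moment mu -> first_moment nu -> lip c h ->
  (W1 dist mu nu <= k%:E)%E ->
  `|Rintegral mu setT h - Rintegral nu setT h| <= c * k.
Proof.
move=> c0 mmu mnu hc Wk.
(* rescaling by a slope c' > c avoids the degenerate slope 0 *)
apply/ler_addgt0Pr => e e0.
have k0 : 0 <= k.
  rewrite -lee_fin; apply: le_trans Wk; apply: le_ereal_inf_tmp => _ [g _ <-].
  by apply: integral_ge0 => z _; rewrite lee_fin (metric_ge0 _ Hmetric).
have k1 : 0 < k + 1 by lra.
pose c' := c + e / (k + 1).
have c'0 : 0 < c' by rewrite ltr_wpDl// divr_gt0.
have h1 : lip 1 (fun z => c'^-1 * h z).
  move=> y z; rewrite mul1r -mulrBr normrM gtr0_norm ?invr_gt0//.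
  rewrite mulrC ler_pdivrMr//; apply: le_trans (hc y z) _; rewrite mulrC.
  by rewrite ler_wpM2l ?(metric_ge0 _ Hmetric)// lerDl divr_ge0// ltW.
have := le_trans (lip_with_W1 _ _ _ mmu mnu h1) Wk.
have ih m : first_moment m -> m.-integrable setT (EFin \o h).
  by move=> mm; exact: lip_with_integrable mm hc.
rewrite !RintegralZl//; [|exact: ih..].
rewrite lee_fin -mulrBr normrM gtr0_norm ?invr_gt0// mulrC ler_pdivrMr// => H.
apply: le_trans H _; rewrite /c' mulrDr mulrC lerD2l.
rewrite mulrCA ler_piMr//; first exact: ltW.
by rewrite ler_pdivrMr// mul1r; lra.
Qed.

Lemma lip_withD c1 c2 h1 h2 : lip c1 h1 -> lip c2 h2 ->
  lip (c1 + c2) (fun z => h1 z + h2 z).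
Proof.
move=> H1 H2 y z; rewrite opprD addrACA mulrDl.
by apply: le_trans (ler_normD _ _) _; rewrite lerD.
Qed.

Lemma lip_withZ c a h : lip c h -> lip (`|a| * c) (fun z => a * h z).
Proof. by move=> H y z; rewrite -mulrBr normrM -mulrA ler_wpM2l. Qed.

Lemma lip_withW c c' h : c <= c' -> lip c h -> lip c' h.
Proof.
move=> cc H y z; apply: le_trans (H y z) _.
by rewrite ler_wpM2r// (metric_ge0 _ Hmetric).
Qed.

End LipschitzIntegral.

(** * Laplace transform of a Lipschitz function under one measure with bounded support *)

Section LocalLaplace.
Context {R : realType} {dT : measure_display} {T : measurableType dT}.
Variable dist : T -> T -> R.
Hypothesis Hmetric : is_metric dist.
Hypothesis Hborel : borel_of dist.
Local Notation lip := (lip_with dist).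

Lemma expR_le_quadratic (t : R) : t <= 2 / 3 -> expR t <= 1 + t + t ^+ 2.
Proof.
(* from [1 - u <= exp (- u)] with [u = t / 4], raised to the fourth power *)
have [u ->] : exists u, t = 4 * u by exists (t / 4); rewrite mulrC divfK.
move=> t23; have u6 : 0 <= 1 - 6 * u by lra.
have H1 : 0 < 1 - u by lra.
have H2 : (1 - u) ^+ 4 <= expR (- (4 * u)).
  rewrite -mulrN expRM_natl; apply: lerXn2r; rewrite ?nnegrE ?expR_ge0 ?(ltW H1)//.
  exact: expR_ge1Dx (- u).
(* The difference of the two sides is [u^2 (6 - 44 u + 81 u^2 - 60 u^3 + 16 u^4)], a nonnegative
   combination of [a1] to [a5]; the factor [1 - 6 u] is the hypothesis [t <= 2 / 3]. *)
have H3 : 1 <= (1 - u) ^+ 4 * (1 + 4 * u + (4 * u) ^+ 2).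
  have a1 : 0 <= u ^+ 2 by exact: sqr_ge0.
  have a2 : 0 <= (u ^+ 3) ^+ 2 by exact: sqr_ge0.
  have a3 : 0 <= (u ^+ 2) ^+ 2 * (1 - 6 * u) by rewrite mulr_ge0 ?sqr_ge0.
  have a4 : 0 <= (u * (1 - 6 * u)) ^+ 2 by exact: sqr_ge0.
  have a5 : 0 <= u ^+ 2 * (1 - 6 * u) by rewrite mulr_ge0.
  lra.
have P : 0 < 1 + 4 * u + (4 * u) ^+ 2.
  have b1 : 0 <= (1 + 8 * u) ^+ 2 by exact: sqr_ge0.
  lra.
have -> : expR (4 * u) = (expR (- (4 * u)))^-1 by rewrite expRN invrK.
rewrite invf_ple ?posrE ?expR_gt0//.
by apply: le_trans H2; rewrite -[leLHS]mul1r ler_pdivrMr.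
Qed.

Variables (mu : probability T R) (sigma : R).
Hypothesis mu_mom : first_moment dist mu.
Hypothesis mu_diam : forall y z, msupp dist mu y -> msupp dist mu z -> dist y z <= 2 * sigma.
Hypothesis mu_supp : mu.-negligible (~` msupp dist mu).

Lemma EFin_Rintegral f : mu.-integrable setT (EFin \o f) ->
  (\int[mu]_z (f z)%:E)%E = (Rintegral mu setT f)%:E.
Proof. by move=> fi; rewrite /Rintegral fineK// integrable_fin_num. Qed.

Lemma Rintegral_cst_probability (r : R) : Rintegral mu setT (fun=> r) = r.
Proof. by rewrite Rintegral_cst// [X in fine X](probability_setT mu) mulr1. Qed.

Lemma integrable_cst_probability (r : R) : mu.-integrable setT (EFin \o (fun=> r)).
Proof. exact: finite_measure_integrable_cst. Qed.

Lemma ae_bounded_integrable (f : T -> R) B : measurable_fun setT f ->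
  (forall y, msupp dist mu y -> `|f y| <= B) -> mu.-integrable setT (EFin \o f).
Proof.
move=> mf fB; apply/integrableP; split; first exact/measurable_EFinP.
apply: le_lt_trans (_ : \int[mu]_z (cst `|B|%R%:E z) < +oo)%E; last first.
  by rewrite integral_cst//= [X in (_ * X)%E](probability_setT mu) mule1 ltry.
apply: ae_ge0_le_integral => //.
- by apply/measurable_EFinP; exact: measurableT_comp.
- by move=> *; rewrite lee_fin.
- apply: negligibleS mu_supp => z /= H sz; apply: H => _.
  by rewrite lee_fin (le_trans (fB z sz))// ler_norm.
Qed.

(** The mean of [h] is an average over the support, whose points are all within [2 * sigma] of [y].
    This is what keeps the argument of the exponential below [2 / 3]. *)
Lemma lip_with_centered_bound c h y : 0 <= c -> lip c h -> msupp dist mu y ->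
  `|h y - Rintegral mu setT h| <= c * (2 * sigma).
Proof.
move=> c0 hc sy.
have ih := lip_with_integrable _ Hmetric Hborel mu c h mu_mom hc.
have ic : mu.-integrable setT (EFin \o cst (h y)) by exact: finite_measure_integrable_cst.
have i1 : mu.-integrable setT (EFin \o (fun z => h y - h z)).
  exact: (integrableB measurableT ic ih).
have -> : h y - Rintegral mu setT h = Rintegral mu setT (fun z => h y - h z).
  by rewrite RintegralB// Rintegral_cst_probability.
apply: le_trans (le_normr_Rintegral measurableT i1) _.
have s0 : 0 <= sigma by have := mu_diam y y sy sy; rewrite (metric_refl _ Hmetric); lra.
rewrite -lee_fin /Rintegral fineK; last first.
  apply: integrable_fin_num => //. exact: integrable_norm.
apply: le_trans (_ : \int[mu]_z (cst (c * (2 * sigma))%:E z) <= _)%E; last first.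
  by rewrite integral_cst//= [X in (_ * X)%E](probability_setT mu) mule1.
apply: ae_ge0_le_integral => //.
- by apply/measurable_EFinP; apply: measurableT_comp => //; case/integrableP: i1 => /measurable_EFinP.
- by move=> *; rewrite lee_fin !mulr_ge0.
- apply: negligibleS mu_supp => z /= H sz; apply: H => _.
  rewrite lee_fin; apply: le_trans (hc y z) _; rewrite ler_wpM2l//.
  exact: mu_diam.
Qed.

Section Variance.
Variables (c : R) (h : T -> R).
Hypotheses (c0 : 0 <= c) (hc : lip c h).
Let a := Rintegral mu setT h.

Let ih : mu.-integrable setT (EFin \o h).
Proof. exact: lip_with_integrable hc. Qed.

Let mh : measurable_fun setT h.
Proof. exact: lip_with_measurable hc. Qed.

Let ia : mu.-integrable setT (EFin \o (fun z => h z - a)).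
Proof. exact: (integrableB measurableT ih (integrable_cst_probability a)). Qed.

Let mean0 : Rintegral mu setT (fun z => h z - a) = 0.
Proof.
by rewrite RintegralB//; [rewrite Rintegral_cst_probability subrr|exact: integrable_cst_probability].
Qed.

Let mha : measurable_fun setT (fun z => h z - a).
Proof. by case/integrableP: ia => /measurable_EFinP. Qed.

Lemma integrable_sqr_centered : mu.-integrable setT (EFin \o (fun z => (h z - a) ^+ 2)).
Proof.
apply: (ae_bounded_integrable _ ((c * (2 * sigma)) ^+ 2)).
  exact: measurable_funX.
move=> y sy; rewrite normrX lerXn2r ?nnegrE//; last exact: lip_with_centered_bound sy.
by apply: le_trans (lip_with_centered_bound _ _ _ c0 hc sy).
Qed.

(** Expand [(h y - h z)^2] around the mean [a]; the cross term integrates to zero. It links the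
    double integrals in [sigma2] and [n_loc] to a variance. *)
Lemma integral_sqr_increment :
  (\int[mu]_y \int[mu]_z ((h y - h z) ^+ 2)%:E)%E =
  (2 * Rintegral mu setT (fun z => (h z - a) ^+ 2))%:E.
Proof.
have iv := integrable_sqr_centered.
set V := Rintegral mu setT _.
have inner y : (\int[mu]_z ((h y - h z) ^+ 2)%:E)%E = ((h y - a) ^+ 2 + V)%:E.
  pose f1 z := - (2 * (h y - a)) * (h z - a).
  have i1 : mu.-integrable setT (EFin \o f1) by exact: (integrableZl measurableT _ ia).
  pose f2 z := f1 z + (h z - a) ^+ 2.
  have i2 : mu.-integrable setT (EFin \o f2) by exact: (integrableD measurableT i1 iv).
  pose f3 z := (h y - a) ^+ 2 + f2 z.
  have i0 := integrable_cst_probability ((h y - a) ^+ 2).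
  have i3 : mu.-integrable setT (EFin \o f3) by exact: (integrableD measurableT i0 i2).
  have -> : (fun z => ((h y - h z) ^+ 2)%:E) = EFin \o f3.
    by apply/funext => z /=; congr EFin; rewrite /f3 /f2 /f1; ring.
  rewrite EFin_Rintegral// /f3 RintegralD// Rintegral_cst_probability /f2 RintegralD//.
  by rewrite /f1 RintegralZl// mean0 mulr0 add0r.
under eq_integral => y _ do rewrite inner.
have iV := integrable_cst_probability V.
rewrite EFin_Rintegral; last exact: (integrableD measurableT integrable_sqr_centered iV).
by rewrite RintegralD// Rintegral_cst_probability mulr_natl mulr2n.
Qed.

Lemma integral_expR_lip_with l v : 0 <= l -> 3 * l * c * sigma <= 1 ->
  (\int[mu]_y \int[mu]_z ((h y - h z) ^+ 2)%:E <= (2 * v)%:E)%E ->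
  (\int[mu]_y (expR (l * h y))%:E <= (expR (l * a + l ^+ 2 * v))%:E)%E.
Proof.
rewrite integral_sqr_increment lee_fin ler_pM2l//.
have iv := integrable_sqr_centered.
move=> l0 ls; set V := Rintegral _ _ _ => Vv.
pose q z := l * (h z - a) + (l * (h z - a)) ^+ 2.
have iq1 : mu.-integrable setT (EFin \o (fun z => l * (h z - a))).
  exact: (integrableZl measurableT _ ia).
have iq2' : mu.-integrable setT (EFin \o (fun z => l ^+ 2 * (h z - a) ^+ 2)).
  exact: (integrableZl measurableT _ iv).
have iq2 : mu.-integrable setT (EFin \o (fun z => (l * (h z - a)) ^+ 2)).
  by apply: eq_integrable iq2' => // z _; rewrite /= exprMn.
have iq : mu.-integrable setT (EFin \o q) by exact: (integrableD measurableT iq1 iq2).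
have i1 : mu.-integrable setT (EFin \o (fun=> 1)) := integrable_cst_probability 1.
have i1q : mu.-integrable setT (EFin \o (fun z => 1 + q z)).
  exact: (integrableD measurableT i1 iq).
have Eq : Rintegral mu setT (fun z => 1 + q z) = 1 + l ^+ 2 * V.
  rewrite RintegralD// Rintegral_cst_probability; congr (_ + _).
  rewrite /q RintegralD// RintegralZl// mean0 mulr0 add0r.
  by under eq_Rintegral => z _ do rewrite exprMn; rewrite RintegralZl.
have main : (\int[mu]_y (expR (l * (h y - a)))%:E <= (expR (l ^+ 2 * v))%:E)%E.
  apply: le_trans (_ : \int[mu]_y ((1 + q y)%:E) <= _)%E; last first.
    rewrite EFin_Rintegral// Eq lee_fin; apply: le_trans (expR_ge1Dx _).
    by rewrite lerD2l ler_wpM2l ?sqr_ge0.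
  apply: ae_ge0_le_integral => //.
  - by apply/measurable_EFinP; apply: measurableT_comp => //; exact: measurable_funM.
  (* The quadratic bound holds only on the support, but the comparison of integrals asks for
     nonnegativity everywhere: [1 + t + t^2 = ((1 + 2 t)^2 + 3) / 4]. *)
  - move=> y _; rewrite lee_fin /q.
    have := sqr_ge0 (1 + 2 * (l * (h y - a))); have := sqr_ge0 (l * (h y - a)); lra.
  - exact: measurable_int i1q.
  apply: negligibleS mu_supp => y /= H sy; apply: H => _.
  rewrite lee_fin /q addrA expR_le_quadratic//.
  have := lip_with_centered_bound _ _ _ c0 hc sy; rewrite -/a => Hb.
  have := ler_norm (h y - a) => Hn.
  have : l * (h y - a) <= l * (c * (2 * sigma)) by rewrite ler_wpM2l//; lra.
  by move=> Hl; apply: le_trans Hl _; rewrite ler_pdivlMr//; lra.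
have -> : (fun y => (expR (l * h y))%:E) =
    (fun y => (expR (l * a))%:E * (expR (l * (h y - a)))%:E)%E.
  by apply/funext => y; rewrite -EFinM -expRD; congr (expR _)%:E; ring.
rewrite ge0_integralZl//; last first.
  by apply/measurable_EFinP; apply: measurableT_comp => //; exact: measurable_funM.
by rewrite expRD EFinM lee_wpmul2l// lee_fin expR_ge0.
Qed.

End Variance.

End LocalLaplace.

(** * The variance of Lipschitz functions under the kernel is controlled by S *)

Section LocalVariance.
Context {R : realType} {dT : measure_display} {T : measurableType dT}.
Variable dist : T -> T -> R.
Hypothesis Hmetric : is_metric dist.
Hypothesis Hpolish : is_polish dist.
Hypothesis Hborel : borel_of dist.
Variable P : T -> probability T R.
Hypothesis HPmom : forall x : T, (\int[P x]_y (dist x y)%:E < +oo)%E.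
Variable kappa : R.
Hypothesis kappa0 : 0 < kappa.
Hypothesis Hsig : (sigma_inf dist P < +oo)%E.
Variable S : T -> R.
Hypothesis HS : forall x : T,
  (sigma2 dist P x * (n_loc dist P x * kappa%:E)^-1 <= (S x)%:E)%E.
Local Notation lip := (lip_with dist).
Local Notation sigma := (fine (sigma_inf dist P)).

Let dist0 := metric_ge0 dist Hmetric.

Lemma first_moment_kernel x : first_moment dist (P x).
Proof. by exists x. Qed.

Lemma msupp_diam x y z : msupp dist (P x) y -> msupp dist (P x) z ->
  dist y z <= 2 * sigma.
Proof.
move=> sy sz.
have H : ((2^-1)%:E * (dist y z)%:E <= sigma_inf dist P)%E.
  rewrite lee_wpmul2l ?lee_fin//.
  apply: le_trans (ereal_sup_ubound _) => /=; last by exists x.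
  by apply: ereal_sup_ubound; exists y, z.
(* Two support points exclude [-oo] and [Hsig] excludes [+oo], so [fine] returns the true value. *)
have fs : sigma_inf dist P \is a fin_num.
  by rewrite ge0_fin_numE//; apply: le_trans H; rewrite -EFinM lee_fin mulr_ge0.
by move: H; rewrite -(fineK fs) -EFinM lee_fin; lra.
Qed.

(** The support of [P x] is nonempty, since otherwise the whole space would be negligible. *)
Lemma sigma_inf_ge0 (x : T) : 0 <= sigma.
Proof.
have [[y sy]|/forallNP n] := pselect (exists y, msupp dist (P x) y).
  by have := msupp_diam x y y sy sy; rewrite (metric_refl _ Hmetric); lra.
have /(negligibleS _) := negligible_setC_msupp dist Hmetric Hborel (P x) Hpolish.
move=> /(_ setT (fun y _ => n y)) [N [mN N0 sN]].
suff : (P x setT <= 0)%E by rewrite (probability_setT (P x)) lee_fin ler10.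
by rewrite -N0 le_measure ?inE.
Qed.

Let negl (x : T) := negligible_setC_msupp dist Hmetric Hborel (P x) Hpolish.
Let int_increment (x : T) := integral_sqr_increment dist Hmetric Hborel (P x) sigma
  (first_moment_kernel x) (msupp_diam x) (negl x).

Lemma integral_sqr_dist_lty x : (\int[P x]_y \int[P x]_z ((dist y z) ^+ 2)%:E < +oo)%E.
Proof.
have [N [mN N0 sN]] := negl x.
pose B : \bar R := ((2 * sigma) ^+ 2)%:E.
have B0 : (0 <= B)%E by rewrite lee_fin sqr_ge0.
have mI : measurable_fun setT (fun y => (\1_N y)%:E : \bar R) by exact/measurable_EFinP.
(* An almost-everywhere comparison would ask for measurability of the inner integral. Adding [+oo]
   on a measurable null set [N] containing the complement of the support gives a pointwise bound
   instead, at no cost in the integral. *)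
apply: le_lt_trans (_ : \int[P x]_y (B + +oo * (\1_N y)%:E) < +oo)%E.
  apply: ge0_le_integralT => y.
    by apply: integral_ge0 => z _; rewrite lee_fin sqr_ge0.
  have [Ny|Ny] := boolP (y \in N).
    by rewrite indicE Ny mule1 addey ?leey.
  rewrite indicE (negbTE Ny) mule0 adde0.
  have sy : msupp dist (P x) y.
    by apply: contrapT => /sN yN; move: Ny; rewrite mem_set.
  have -> : B = (\int[P x]_z cst B z)%E.
    by rewrite integral_cst//= [X in (_ * X)%E](probability_setT (P x)) mule1.
  apply: ae_ge0_le_integral => //.
    by move=> z _; rewrite lee_fin sqr_ge0.
    apply/measurable_EFinP; apply: measurable_funX.
    exact: lip_with_measurable (lip_with_dist _ Hmetric y).
  apply: negligibleS (negl x) => z /= H sz; apply: H => _.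
  by rewrite lee_fin lerXn2r ?nnegrE// ?mulr_ge0 ?(sigma_inf_ge0 x)// (msupp_diam x).
rewrite ge0_integralD//; last exact: measurable_funeM.
rewrite ge0_integralZl// integral_indic// setIT [X in (+oo * X)%E]N0 mule0 adde0 integral_cst//=.
by rewrite [X in (_ * X)%E](probability_setT (P x)) mule1 ltry.
Qed.

Lemma variance_proxy_ge0 x : 0 <= S x.
Proof.
rewrite -lee_fin; apply: le_trans (HS x).
have I0 : (0 <= \int[P x]_y \int[P x]_z ((dist y z) ^+ 2)%:E)%E.
  by apply: integral_ge0 => y _; apply: integral_ge0 => z _; rewrite lee_fin sqr_ge0.
rewrite mule_ge0 ?inve_ge0 ?mule_ge0//; last by rewrite lee_fin ltW.
apply: le_ereal_inf_tmp => _ [g _ <-]; rewrite mule_ge0// inve_ge0.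
by apply: integral_ge0 => y _; apply: integral_ge0 => z _; rewrite lee_fin sqr_ge0.
Qed.

(** In the regular case, [n_x <= I / J] and [(I / 2) / (n_x kappa) <= S x] give [J <= 2 kappa S x],
    with [I] and [J] the double integrals for [dist] and [g]. The rest of the proof treats the
    degenerate ratios. *)
Lemma sqr_increment_lip1_le x g : lip 1 g ->
  (\int[P x]_y \int[P x]_z ((g y - g z) ^+ 2)%:E <= (2 * (kappa * S x))%:E)%E.
Proof.
move=> g1; have S0 := variance_proxy_ge0 x.
have JI : (\int[P x]_y \int[P x]_z ((g y - g z) ^+ 2)%:E <=
           \int[P x]_y \int[P x]_z ((dist y z) ^+ 2)%:E)%E.
  apply: ge0_le_integralT => y.
    by apply: integral_ge0 => z _; rewrite lee_fin sqr_ge0.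
  apply: ge0_le_integralT => z; first by rewrite lee_fin sqr_ge0.
  by rewrite lee_fin -real_normK ?num_real// lerXn2r ?nnegrE//; have := g1 y z; rewrite mul1r.
have := HS x; rewrite /sigma2.
have : (n_loc dist P x <= (\int[P x]_y \int[P x]_z ((dist y z) ^+ 2)%:E) *
  (\int[P x]_y \int[P x]_z ((g y - g z) ^+ 2)%:E)^-1)%E.
  apply: ereal_inf_lbound; exists g => // y z.
  by have := g1 y z; rewrite mul1r.
have : (0 <= n_loc dist P x)%E.
  apply: le_ereal_inf_tmp => _ [g' _ <-].
  by rewrite mule_ge0// ?inve_ge0; apply: integral_ge0 => y _; apply: integral_ge0 => z _;
    rewrite lee_fin sqr_ge0.
move: JI (integral_sqr_dist_lty x).
rewrite (int_increment x 1 g ler01 g1); set V := Rintegral _ _ _.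
case: (\int[P x]_y _)%E => [I| |]//; rewrite lee_fin => JI _.
rewrite !lee_fin ler_pM2l// => n0 nIJ.
(* When [J] vanishes the ratio says nothing about [g], but the claim follows from [S x >= 0].
   Otherwise [I >= J > 0] and the ratio is an honest quotient. *)
have [V0 _|V0] := leP V 0; first by apply: le_trans V0 _; rewrite mulr_ge0// ltW.
move: nIJ; rewrite inver gt_eqF ?mulr_gt0// -EFinM.
move: n0; case: (n_loc dist P x) => [n| |]//; rewrite !lee_fin => n0.
rewrite ler_pdivlMr ?mulr_gt0// => nIJ.
rewrite -!EFinM inver.
(* If [n_x] were zero, its inverse would be [+oo], and [sigma2], being positive here, would push the
   left side of [HS] to [+oo]. *)
have [nk0|nk] := eqVneq (n * kappa) 0.
  by rewrite gt0_muley ?lte_fin ?mulr_gt0 ?invr_gt0//; lra.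
have np : 0 < n.
  by rewrite lt_neqAle n0 andbT eq_sym; apply: contra_neq nk => ->; rewrite mul0r.
rewrite -EFinM lee_fin ler_pdivrMr ?mulr_gt0// => H.
rewrite -(ler_pM2l np); lra.
Qed.

Lemma sqr_increment_lip_le x c h : 0 < c -> lip c h ->
  (\int[P x]_y \int[P x]_z ((h y - h z) ^+ 2)%:E <= (2 * (c ^+ 2 * kappa * S x))%:E)%E.
Proof.
move=> c0 hc.
pose g z := c^-1 * h z.
have g1 : lip 1 g.
  move=> y z; rewrite mul1r -mulrBr normrM gtr0_norm ?invr_gt0//.
  by rewrite mulrC ler_pdivrMr// mulrC hc.
have := sqr_increment_lip1_le x g g1.
have hg z : h z = c * g z by rewrite /g mulrA divff ?mul1r ?gt_eqF.
have ig := integrable_sqr_centered dist Hmetric Hborel (P x) sigma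
  (first_moment_kernel x) (msupp_diam x) (negl x) 1 g ler01 g1.
rewrite (int_increment x 1 g ler01 g1) (int_increment x c h (ltW c0) hc).
rewrite !lee_fin !ler_pM2l//.
have -> : Rintegral (P x) setT h = c * Rintegral (P x) setT g.
  rewrite -RintegralZl//; last exact: lip_with_integrable (first_moment_kernel x) g1.
  by apply: eq_Rintegral => z _; exact: hg.
set A := Rintegral (P x) setT g => H.
have -> : Rintegral (P x) setT (fun z => (h z - c * A) ^+ 2) =
    c ^+ 2 * Rintegral (P x) setT (fun z => (g z - A) ^+ 2).
  rewrite -[RHS](RintegralZl _ measurableT ig).
  by apply: eq_Rintegral => z _; rewrite hg -mulrBr exprMn.
by rewrite -mulrA ler_wpM2l ?sqr_ge0.
Qed.

(** The variance term is placed inside the factor [l]: the bound is again the exponential of [l]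
    times a function, so it can be fed to the next step. *)
Lemma kernel_expR_lip_le x c h l : 0 < c -> lip c h -> 0 <= l -> 3 * l * c * sigma <= 1 ->
  (\int[P x]_y (expR (l * h y))%:E <=
    (expR (l * (Rintegral (P x) setT h + l * c ^+ 2 * kappa * S x)))%:E)%E.
Proof.
move=> c0 hc l0 ls.
have -> : l * (Rintegral (P x) setT h + l * c ^+ 2 * kappa * S x) =
  l * Rintegral (P x) setT h + l ^+ 2 * (c ^+ 2 * kappa * S x) by ring.
apply: (integral_expR_lip_with dist Hmetric Hborel (P x) sigma
  (first_moment_kernel x) (msupp_diam x) (negl x) c h (ltW c0) hc) => //.
exact: sqr_increment_lip_le.
Qed.

End LocalVariance.

(** * The averaging operator, Green sums and the backward recursion *)

Section AveragingOperator.
Context {R : realType} {dT : measure_display} {T : measurableType dT}.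
Variable dist : T -> T -> R.
Hypothesis Hmetric : is_metric dist.
Hypothesis Hborel : borel_of dist.
Variable P : T -> probability T R.
Hypothesis HPmeas : forall A : set T, measurable A -> measurable_fun setT (fun x => P x A).
Hypothesis HPmom : forall x : T, (\int[P x]_y (dist x y)%:E < +oo)%E.
Variable kappa : R.
Hypotheses (kappa0 : 0 < kappa) (kappa1 : kappa <= 1).
Hypothesis Hcontr : forall x y : T,
  (W1 dist (P x) (P y) <= ((1 - kappa) * dist x y)%:E)%E.
Local Notation lip := (lip_with dist).

Definition averaging (h : T -> R) (y : T) : R := Rintegral (P y) setT h.

Lemma lip_integrable_kernel y c h : lip c h -> (P y).-integrable setT (EFin \o h).
Proof. by apply: lip_with_integrable => //; exists y. Qed.

Lemma integral_kernel_averaging y c h : lip c h ->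
  (\int[P y]_z (h z)%:E)%E = (averaging h y)%:E.
Proof. by move=> hc; rewrite (EFin_Rintegral (P y))//; exact: lip_integrable_kernel hc. Qed.

Lemma averaging_lip c h : 0 <= c -> lip c h -> lip (c * (1 - kappa)) (averaging h).
Proof.
move=> c0 hc y z; rewrite -mulrA.
by apply: (Rintegral_lip_with_contract dist) hc (Hcontr y z) => //; [exists y|exists z].
Qed.

Lemma averaging_ge0 h y : (forall z, 0 <= h z) -> 0 <= averaging h y.
Proof. by move=> h0; exact: Rintegral_ge0. Qed.

Lemma averagingD c1 c2 h1 h2 y : lip c1 h1 -> lip c2 h2 ->
  averaging (fun z => h1 z + h2 z) y = averaging h1 y + averaging h2 y.
Proof. by move=> l1 l2; apply: RintegralD => //; apply: lip_integrable_kernel; eassumption. Qed.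

Lemma averagingZ c a h y : lip c h -> averaging (fun z => a * h z) y = a * averaging h y.
Proof. by move=> l; apply: RintegralZl => //; exact: lip_integrable_kernel l. Qed.

Section Backward.
Variables (S : T -> R) (C : R).
Hypotheses (C0 : 0 <= C) (SC : lip C S) (S0 : forall y, 0 <= S y).

(* [green k] is the sum of [P^j S] over [j < k]. *)
Fixpoint green (k : nat) : T -> R :=
  if k is k'.+1 then fun y => S y + averaging (green k') y else fun=> 0.

Lemma green_ge0 k y : 0 <= green k y.
Proof. by elim: k y => [//|k IH] y /=; rewrite addr_ge0// averaging_ge0. Qed.

(** The slope [C / kappa] is the fixed point of [a = C + (1 - kappa) a]. *)
Lemma green_lip k : lip (C / kappa) (green k).
Proof.
have Ck : 0 <= C / kappa by rewrite divr_ge0// ltW.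
elim: k => [|k IH] /=.
  by move=> y z; rewrite subrr normr0 mulr_ge0// (metric_ge0 _ Hmetric).
have -> : C / kappa = C + C / kappa * (1 - kappa).
  by rewrite mulrBr mulr1 divfK ?gt_eqF// addrC subrK.
by apply: lip_withD => //; exact: averaging_lip.
Qed.

Variables (f : T -> R) (w : nat -> R).
Hypotheses (f1 : lip 1 f) (w1 : forall n, `|w n| <= 1).

(* [k] is the number of remaining steps and [n] the current time: for [s = 0] the value at [y] is
   the conditional mean of the sum of [w i * f (X i)] over [n <= i <= n + k] given [X n = y]. *)
Fixpoint backward (s : R) (k n : nat) : T -> R :=
  if k is k'.+1 then fun y => w n * f y + (averaging (backward s k' n.+1) y + s * S y)
  else fun y => w n * f y.

(** One step gives the slope [1 + (2 / kappa) (1 - kappa) + s C = 2 / kappa - 1 + s C], so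
    [s C <= 1] closes the induction. It starts because [kappa <= 1] makes [2 / kappa] at least 1. *)
Lemma backward_lip s k n : 0 <= s -> s * C <= 1 -> lip (2 / kappa) (backward s k n).
Proof.
move=> s0 sC.
have k0 : 0 <= 2 / kappa by rewrite divr_ge0// ltW.
have k2 : 2 <= 2 / kappa by rewrite ler_pdivlMr// ler_piMr.
have wf m : lip 1 (fun y => w m * f y).
  apply: (lip_withW dist Hmetric (`|w m| * 1)); first by rewrite mulr1.
  exact: lip_withZ.
elim: k n => [|k IH] n /=; first by apply: (lip_withW dist Hmetric 1) (wf n); rewrite (le_trans _ k2)// ler1n.
apply: (lip_withW dist Hmetric (1 + (2 / kappa * (1 - kappa) + `|s| * C))).
  rewrite ger0_norm// mulrBr mulr1 divfK ?gt_eqF//; lra.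
by apply: lip_withD => //; apply: lip_withD; [exact: averaging_lip|exact: lip_withZ].
Qed.

(** The recursion is affine in [s] and averaging is linear, so the S terms accumulate independently
    of [f] and of the weights. *)
Lemma backward_green s k n y : 0 <= s -> s * C <= 1 ->
  backward s k n y = backward 0 k n y + s * green k y.
Proof.
move=> s0 sC.
elim: k n y => [|k IH] n y /=; first by rewrite mulr0 addr0.
have l0 : lip (2 / kappa) (backward 0 k n.+1) by apply: backward_lip; rewrite ?mul0r.
have lg := green_lip k.
have -> : averaging (backward s k n.+1) y =
    averaging (backward 0 k n.+1) y + s * averaging (green k) y.
  rewrite -(averagingZ _ s _ y lg) -(averagingD _ _ _ _ y l0 (lip_withZ _ _ s _ lg)).
  by apply: eq_Rintegral => z _; exact: IH.
by rewrite mul0r addr0 mulrDr; ring.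
Qed.

End Backward.
End AveragingOperator.

Section DiracMixture.
Context {R : realType} {d d' : measure_display} {Om : measurableType d} {T : measurableType d'}.
Local Open Scope ereal_scope.

(** Dirac kernels let a function evaluated along [Y] be viewed as a mixture, so that [eq_mixint] can
    replace it by an indicator. *)
Lemma mixint_dirac (mu : {measure set Om -> \bar R}) (W : Om -> \bar R) (Y : Om -> T)
    (h : T -> \bar R) : measurable_fun setT h ->
  mixint mu W (fun w => \d_(Y w)) h = \int[mu]_w (W w * h (Y w)).
Proof.
move=> mh; apply: eq_integral => w _.
by rewrite integral_dirac//= diracT mul1e.
Qed.

Lemma measurable_fun_dirac_comp (Y : Om -> T) (A : set T) : measurable_fun setT Y ->
  measurable A -> measurable_fun setT (fun w => \d_(Y w) A : \bar R).
Proof.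
move=> mY mA; apply/measurable_EFinP.
by rewrite (_ : (fun w => _) = \1_A \o Y)//; exact: measurableT_comp.
Qed.

End DiracMixture.

(** * The invariant measure: stationarity for functions, first moment, mean of the Green sums *)

Section InvariantProbability.
Context {R : realType} {dT : measure_display} {T : measurableType dT}.
Variable dist : T -> T -> R.
Hypothesis Hmetric : is_metric dist.
Hypothesis Hborel : borel_of dist.
Variable P : T -> probability T R.
Hypothesis HPmeas : forall A : set T, measurable A -> measurable_fun setT (fun x => P x A).
Hypothesis HPmom : forall x : T, (\int[P x]_y (dist x y)%:E < +oo)%E.
Variable kappa : R.
Hypotheses (kappa0 : 0 < kappa) (kappa1 : kappa <= 1).
Hypothesis Hcontr : forall x y : T,
  (W1 dist (P x) (P y) <= ((1 - kappa) * dist x y)%:E)%E.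
Variable pi : probability T R.
Hypothesis Hinv : invariant_prob P pi.
Local Notation lip := (lip_with dist).

Lemma integral_invariant (h : T -> \bar R) : (forall z, 0 <= h z)%E ->
  measurable_fun setT h -> (\int[pi]_y \int[P y]_z h z = \int[pi]_z h z)%E.
Proof.
move=> h0 mh.
have E := eq_mixint pi (cst 1%E) P pi (cst 1%E) (fun y => \d_y).
have -> : (\int[pi]_y \int[P y]_z h z = mixint pi (cst 1%E) P h)%E.
  by apply: eq_integral => y _; rewrite mul1e.
rewrite E//; last first.
  move=> A mA.
  under eq_integral => y _ do rewrite mul1e.
  rewrite Hinv//; under [RHS]eq_integral => y _ do rewrite mul1e.
  by rewrite -[A in LHS]setIT -integral_indic.
  by move=> A mA; exact: (measurable_fun_dirac_comp id).
by rewrite (mixint_dirac pi _ id)//; apply: eq_integral => y _; rewrite mul1e.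
Qed.

(** A drift inequality for [dist x0]: contraction turns the slope 1 into [1 - kappa], up to the
    constant value at [x0]. *)
Lemma averaging_dist_le x0 y :
  averaging P (dist x0) y <= (1 - kappa) * dist x0 y + averaging P (dist x0) x0.
Proof.
have := averaging_lip dist Hmetric Hborel P HPmom kappa Hcontr 1 (dist x0) ler01
  (lip_with_dist _ Hmetric x0) x0 y.
by rewrite mul1r => /ler_normlP[H _]; lra.
Qed.

(* Stationarity is only available for integrable functions, so it is applied to the truncation
   [min V K] of [V = dist x0]; the mass of [V] on [V <= K] is then bounded uniformly in [K]. *)
Lemma integral_truncated_dist_le x0 (K : R) : 0 <= K ->
  (\int[pi]_y (kappa * (dist x0 y * \1_[set z | dist x0 z <= K]%R y))%:E
   <= (averaging P (dist x0) x0)%:E)%E.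
Proof.
move=> K0; set J := averaging P (dist x0) x0.
(* [N] dominates the average of the truncation [m]: averaging [min V K] gives at most [K], and at
   most the drift bound. Stationarity then yields that the mean of [m] is at most that of [N]. *)
pose V := dist x0; pose m y := Num.min (V y) K.
pose N y : R := Num.min ((1 - kappa) * V y + J) K.
have V0 y : 0 <= V y := metric_ge0 _ Hmetric x0 y.
have mV : measurable_fun setT V := lip_with_measurable _ Hmetric Hborel _ _ (lip_with_dist _ Hmetric x0).
have J0 : 0 <= J by exact: averaging_ge0.
have mm : measurable_fun setT m by exact: measurable_minr.
have mN : measurable_fun setT N.
  apply: measurable_minr => //; apply: measurable_funD => //; exact: measurable_funM.
have m0 y : 0 <= m y by rewrite le_min V0 K0.
have N0 y : 0 <= N y by rewrite le_min K0 addr_ge0// mulr_ge0// subr_ge0.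
have bi (mu : probability T R) (g : T -> R) : measurable_fun setT g -> (forall y, 0 <= g y <= K) ->
    mu.-integrable setT (EFin \o g).
  move=> mg gK; apply: (@le_integrable _ _ _ _ setT measurableT _ (EFin \o cst K)).
  - exact/measurable_EFinP.
  - by move=> y _; rewrite /= lee_fin; have /andP[g0 g1] := gK y; rewrite !ger0_norm.
  - exact: finite_measure_integrable_cst.
have mK y : 0 <= m y <= K by rewrite m0 ge_min lexx orbT.
have NK y : 0 <= N y <= K by rewrite N0 ge_min lexx orbT.
have mN_le : (\int[pi]_y (m y)%:E <= \int[pi]_y (N y)%:E)%E.
  rewrite -(integral_invariant (EFin \o m))//; last exact/measurable_EFinP.
  apply: ge0_le_integralT => y.
    by apply: integral_ge0 => z _; rewrite lee_fin.
  rewrite (EFin_Rintegral (P y) m); last exact: bi.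
  rewrite lee_fin le_min; apply/andP; split.
    apply: le_trans (averaging_dist_le x0 y).
    apply: le_Rintegral => //; first exact: bi.
      exact: (lip_integrable_kernel dist Hmetric Hborel P HPmom y 1 _ (lip_with_dist _ Hmetric x0)).
    by move=> z _; rewrite ge_min lexx.
  rewrite -[leRHS](Rintegral_cst_probability (P y) K).
  apply: le_Rintegral => //; [exact: bi|exact: integrable_cst_probability|].
  by move=> z _; rewrite ge_min lexx orbT.
have im := bi pi m mm mK; have iN := bi pi N mN NK.
rewrite (EFin_Rintegral pi m im) (EFin_Rintegral pi N iN) lee_fin in mN_le.
have iJm : pi.-integrable setT (EFin \o (fun y => J + m y)).
  exact: (integrableD measurableT (integrable_cst_probability pi J) im).
have i3 : pi.-integrable setT (EFin \o (fun y => J + m y - N y)).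
  exact: (integrableB measurableT iJm iN).
apply: le_trans (_ : \int[pi]_y (J + m y - N y)%:E <= _)%E; last first.
  rewrite (EFin_Rintegral pi)// lee_fin RintegralB// RintegralD//; last exact: integrable_cst_probability.
  by rewrite Rintegral_cst_probability; lra.
apply: ge0_le_integralT => y.
  by rewrite lee_fin mulr_ge0 ?(ltW kappa0)// mulr_ge0.
(* Pointwise, [J + m - N] is at least [kappa V] where [V <= K], by the drift part of [N], and at
   least [J >= 0] elsewhere, where [m = K >= N]. *)
rewrite lee_fin -/V /m /N indicE.
have [/set_mem/= VK|/negP VK] := boolP (y \in [set z | V z <= K]).
  rewrite mulr1 (min_idPl VK).
  have := ge_min ((1 - kappa) * V y + J) ((1 - kappa) * V y + J) K.
  by rewrite lexx /= => H; rewrite -/(V y); lra.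
have {}VK : K < V y by rewrite ltNge; apply/negP => H; apply: VK; rewrite inE.
rewrite !mulr0 (min_idPr (ltW VK)).
have := ge_min K ((1 - kappa) * V y + J) K.
by rewrite lexx orbT => H; lra.
Qed.

(** Let [K] run through the integers in the truncated bound: monotone convergence gives [kappa]
    times the mean of [dist x0] at most [J]. A base point [x0] exists since pi has mass 1. *)
Lemma first_moment_invariant : first_moment dist pi.
Proof.
have [x0 _] : exists x0 : T, True.
  apply: contrapT => n; have : (pi setT <= 0)%E.
    rewrite (_ : setT = set0) ?measure0//; apply/seteqP; split => // y _.
    by apply: n; exists y.
  by rewrite (probability_setT pi) lee_fin ler10.
exists x0; set J := averaging P (dist x0) x0.
pose V := dist x0.
have V0 y : 0 <= V y := metric_ge0 _ Hmetric x0 y.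
have mV : measurable_fun setT V := lip_with_measurable _ Hmetric Hborel _ _ (lip_with_dist _ Hmetric x0).
pose g (n : nat) y := (kappa * (V y * \1_[set z | V z <= n%:R] y))%:E.
have mg n : measurable_fun setT (g n).
  apply/measurable_EFinP; apply: measurable_funM => //; apply: measurable_funM => //.
  apply: measurable_indic; rewrite -[X in measurable X]setTI.
  exact: measurable_fun_le.
have g0 n y : (0 <= g n y)%E by rewrite lee_fin mulr_ge0 ?mulr_ge0// ltW.
have nd y : nondecreasing_seq (g ^~ y).
  move=> a b ab; rewrite lee_fin; apply: ler_wpM2l; first exact: ltW.
  apply: ler_wpM2l => //; rewrite !indicE.
  have [/set_mem/= H|_] := boolP (y \in [set z | V z <= a%:R]); last exact: ler0n.
  by rewrite mem_set//=; apply: le_trans H _; rewrite ler_nat.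
have cv y : g ^~ y @ \oo --> (kappa * V y)%:E.
  apply: cvg_near_cst; exists (Num.truncn (V y)).+1 => // n /= Hn.
  rewrite /g indicE mem_set ?mulr1//=.
  by apply: le_trans (ltW (truncnS_gt _)) _; rewrite ler_nat.
have := @cvg_monotone_convergence _ _ _ pi setT measurableT g (fun n => mg n)
  (fun n y _ => g0 n y) (fun y _ => nd y).
have -> : (\int[pi]_x limn (g^~ x) = \int[pi]_y (kappa%:E * (V y)%:E))%E.
  by apply: eq_integral => y _; apply/cvg_lim => //; exact: cv.
move=> c.
have : (\int[pi]_y (kappa%:E * (V y)%:E) <= J%:E)%E.
  rewrite -(cvg_lim _ c)//; apply: lime_le; first by apply/cvg_ex; eexists; exact: c.
  by apply: nearW => n; exact: integral_truncated_dist_le.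
rewrite (ge0_integralZl _ measurableT (f := EFin \o V)); [|exact/measurable_EFinP| |]; last 2 first.
- by move=> y _; rewrite lee_fin.
- by rewrite lee_fin ltW.
move=> /le_lt_trans/(_ (ltry _)).
have : (0 <= \int[pi]_y (V y)%:E)%E by apply: integral_ge0 => y _; rewrite lee_fin.
case: integral => [r _ _|_|//]; first exact: ltry.
by rewrite gt0_muley.
Qed.

Lemma Rintegral_averaging_invariant c h : lip c h -> (forall y, 0 <= h y) ->
  Rintegral pi setT (averaging P h) = Rintegral pi setT h.
Proof.
move=> hc h0; congr fine.
rewrite -(integral_invariant (EFin \o h))//; last first.
  by apply/measurable_EFinP; exact: lip_with_measurable hc.
by apply: eq_integral => y _; rewrite /= (integral_kernel_averaging dist Hmetric Hborel P HPmom y c).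
Qed.

Section Green.
Variables (S : T -> R) (C : R).
Hypotheses (C0 : 0 <= C) (SC : lip C S) (S0 : forall y, 0 <= S y).

Let ipi c h : lip c h -> pi.-integrable setT (EFin \o h).
Proof. by apply: lip_with_integrable => //; exact: first_moment_invariant. Qed.

Let lip_green k := green_lip dist Hmetric Hborel P HPmom kappa kappa0 Hcontr S C C0 SC k.

Lemma Rintegral_green k : Rintegral pi setT (green P S k) = k%:R * Rintegral pi setT S.
Proof.
elim: k => [|k IH] /=; first by rewrite Rintegral_cst_probability mul0r.
rewrite RintegralD//; last 2 first.
- exact: ipi SC.
- apply: ipi; apply: (averaging_lip dist Hmetric Hborel P HPmom kappa Hcontr _ _ _ (lip_green k)).
  by rewrite divr_ge0// ltW.
rewrite (Rintegral_averaging_invariant _ _ (lip_green k)); last by move=> y; exact: green_ge0.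
by rewrite IH -natr1; ring.
Qed.

Lemma green_le k x :
  green P S k x <= k%:R * Rintegral pi setT S + C / kappa * Emean dist pi x.
Proof.
have id := ipi _ _ (lip_with_dist _ Hmetric x).
rewrite -Rintegral_green /Emean -RintegralZl//.
have iZ : pi.-integrable setT (EFin \o (fun y => C / kappa * dist x y)).
  exact: (integrableZl measurableT _ id).
have ig := ipi _ _ (lip_green k).
rewrite -RintegralD// -[leLHS](Rintegral_cst_probability pi).
apply: le_Rintegral => //; first exact: integrable_cst_probability.
  exact: (integrableD measurableT ig iZ).
by move=> y _ /=; rewrite -lerBlDl; apply: le_trans (ler_norm _) (lip_green k x y).
Qed.

End Green.

End InvariantProbability.

(** * The Markov property for products of functions of the coordinates *)

Section MarkovChain.
Context {R : realType} {dT : measure_display} {T : measurableType dT}.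
Variable P : T -> probability T R.
Hypothesis HPmeas : forall A : set T, measurable A -> measurable_fun setT (fun x => P x A).
Context {dO : measure_display} {Omega : measurableType dO}.
Variables (Pr : probability Omega R) (X : nat -> Omega -> T) (x : T).
Hypothesis HX : markov_chain_from P Pr X x.

Lemma chain_measurable n : measurable_fun setT (X n).
Proof. by case: HX. Qed.

Lemma chain_comp_measurable n (h : T -> R) : measurable_fun setT h ->
  measurable_fun setT (h \o X n).
Proof. by move=> mh; apply: measurableT_comp => //; exact: chain_measurable. Qed.

Let history n (phi : nat -> T -> R) w := \prod_(i < n) phi i (X i w).

Let history_ge0 n phi w : (forall i z, 0 <= phi i z) -> 0 <= history n phi w.
Proof. by move=> phi0; apply: prodr_ge0 => i _. Qed.

Let history_measurable n phi : (forall i, measurable_fun setT (phi i)) ->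
  measurable_fun setT (history n phi).
Proof.
move=> mphi; apply: measurable_prod => i _; exact: (chain_comp_measurable i (phi i)).
Qed.

Let markov_indic n (B : nat -> set T) A : (forall i, measurable (B i)) -> measurable A ->
  (\int[Pr]_w ((history n.+1 (fun i => \1_(B i)) w)%:E * (\1_A (X n.+1 w))%:E) =
   \int[Pr]_w ((history n.+1 (fun i => \1_(B i)) w)%:E * P (X n w) A))%E.
Proof.
move=> mB mA.
pose D := [set w | forall i, (i <= n)%N -> B i (X i w)].
have mD : measurable D.
  rewrite (_ : D = \bigcap_(i in [set i | (i <= n)%N]) (X i @^-1` B i)).
    apply: bigcap_measurableType => i _; rewrite -[X in measurable X]setTI.
    exact: chain_measurable.
  by apply/seteqP; split => w.
have hD w : history n.+1 (fun i => \1_(B i)) w = \1_D w.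
  have [/set_mem Dw|nD] := boolP (w \in D).
    rewrite indicE mem_set// /history big1// => i _; rewrite indicE mem_set//.
    by apply: Dw; rewrite -ltnS.
  rewrite indicE (negbTE nD); apply/eqP; rewrite /history prodf_seq_eq0.
  have [i [ni nB]] : exists i, (i <= n)%N /\ ~ B i (X i w).
    apply: contrapT => H; move/negP: nD; apply; rewrite inE => i ni.
    by apply: contrapT => nB; apply: H; exists i.
  apply/hasP; exists (inord i : 'I_n.+1); first by rewrite mem_index_enum.
  by rewrite /= indicE memNset ?eqxx// inordK.
(* The chain hypothesis takes one sequence of sets indexed up to [n.+1]; [A'] joins the constraints
   [B] on the past to the set [A] at the last time. *)
pose A' i := if i == n.+1 then A else B i.
have [_ [_ /(_ n A')]] := HX.
have mA' i : measurable (A' i) by rewrite /A'; case: ifP.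
move=> /(_ mA').
rewrite /A' eqxx.
have -> : [set w | forall i, (i <= n)%N -> (if i == n.+1 then A else B i) (X i w)] = D.
  apply/seteqP; split => w H i ni; have := H i ni; rewrite ltn_eqF ?ltnS//.
have -> : [set w | forall i, (i <= n.+1)%N -> (if i == n.+1 then A else B i) (X i w)]
    = D `&` X n.+1 @^-1` A.
  apply/seteqP; split => [w H|w [H1 H2] i].
    split=> [i ni|]; last by have := H n.+1 (leqnn _); rewrite eqxx.
    by have := H i (leqW ni); rewrite ltn_eqF ?ltnS.
  by rewrite leq_eqVlt ltnS => /predU1P[->|ni]; [rewrite eqxx|rewrite ltn_eqF ?ltnS//; exact: H1].
move=> E.
transitivity (Pr (D `&` X n.+1 @^-1` A)); last rewrite E.
  have mXA : measurable (X n.+1 @^-1` A).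
    by rewrite -[X in measurable X]setTI; exact: chain_measurable.
  transitivity (\int[Pr]_w (\1_(D `&` X n.+1 @^-1` A) w)%:E)%E.
    by apply: eq_integral => w _; rewrite hD -EFinM indicI.
  by rewrite integral_indic ?setIT//; exact: measurableI.
rewrite integral_mkcond; apply: eq_integral => w _.
rewrite hD indicE patchE; case: ifP => _; last by rewrite mul0e.
by rewrite mul1e.
Qed.

(** Induction on the number [j] of coordinates that carry an arbitrary function, the others carrying
    indicators. Both sides are mixtures of Dirac masses at [X j w], integrated against the factor
    [phi j], so agreement for indicators in place of [phi j], the induction hypothesis, is
    enough. *)
Let markov_partial j n (phi : nat -> T -> R) A : (j <= n.+1)%N ->
  (forall i z, 0 <= phi i z) -> (forall i, measurable_fun setT (phi i)) ->
  (forall i, (j <= i)%N -> exists2 B, measurable B & phi i = \1_B) -> measurable A ->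
  (\int[Pr]_w ((history n.+1 phi w)%:E * (\1_A (X n.+1 w))%:E) =
   \int[Pr]_w ((history n.+1 phi w)%:E * P (X n w) A))%E.
Proof.
elim: j phi => [|j IH] phi jn phi0 mphi ind mA.
  have /choice[B HB] : forall i, exists B, measurable B /\ phi i = \1_B.
    by move=> i; have [B mB ->] := ind i (leq0n i); exists B.
  have -> : phi = fun i => \1_(B i) by apply/funext => i; have [_] := HB i.
  by apply: markov_indic => // i; have [] := HB i.
pose o : 'I_n.+1 := Ordinal jn.
pose rest w := \prod_(i < n.+1 | i != o) phi i (X i w).
have hE psi w : (forall i, i != j -> psi i = phi i) ->
    history n.+1 psi w = psi j (X j w) * rest w.
  move=> H; rewrite /history (bigD1 o)//=; congr (_ * _).
  by apply: eq_bigr => i io; rewrite H.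
have rest0 w : 0 <= rest w by apply: prodr_ge0 => i _.
have mrest : measurable_fun setT rest.
  have -> : rest = fun w => \prod_(i < n.+1) (if i != o then phi i (X i w) else 1).
    by apply/funext => w; rewrite /rest big_mkcond.
  apply: (measurable_prod (h := fun (i : 'I_n.+1) w => if i != o then phi i (X i w) else 1)).
  move=> i _; case: (i != o) => //.
  exact: (chain_comp_measurable i (phi i)).
have mXj := chain_measurable j.
have m1 : measurable_fun setT (fun w => \1_A (X n.+1 w) : R).
  by apply: (chain_comp_measurable n.+1 (\1_A)); exact: measurable_indic.
have m2 : measurable_fun setT (fun w => P (X n w) A).
  by apply: (measurableT_comp (HPmeas A mA)); exact: chain_measurable.
have mr : measurable_fun setT (fun w => (rest w)%:E) by exact/measurable_EFinP.
pose W1 w := ((rest w)%:E * (\1_A (X n.+1 w))%:E)%E.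
pose W2 w := ((rest w)%:E * P (X n w) A)%E.
have -> : (\int[Pr]_w ((history n.+1 phi w)%:E * (\1_A (X n.+1 w))%:E) =
    mixint Pr W1 (fun w => \d_(X j w)) (EFin \o phi j))%E.
  rewrite mixint_dirac; last by exact/measurable_EFinP.
  by apply: eq_integral => w _; rewrite hE// EFinM /W1 /= -muleA muleC.
have -> : (\int[Pr]_w ((history n.+1 phi w)%:E * P (X n w) A) =
    mixint Pr W2 (fun w => \d_(X j w)) (EFin \o phi j))%E.
  rewrite mixint_dirac; last by exact/measurable_EFinP.
  by apply: eq_integral => w _; rewrite hE// EFinM /W2 /= -muleA muleC.
apply: eq_mixint => //.
- by move=> w; rewrite mule_ge0// lee_fin.
- by apply: emeasurable_funM => //; exact/measurable_EFinP.
- by move=> B mB; exact: measurable_fun_dirac_comp.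
- by move=> w; rewrite mule_ge0// lee_fin.
- by move=> w; rewrite fin_numM// fin_num_measure.
- exact: emeasurable_funM.
- by move=> B mB; exact: measurable_fun_dirac_comp.
- move=> B mB; pose psi i := if i == j then \1_B else phi i.
  have psiE i : i != j -> psi i = phi i by rewrite /psi => /negbTE ->.
  have psij w : psi j (X j w) = \1_B (X j w) by rewrite /psi eqxx.
  have hpsi w : (history n.+1 psi w)%:E = ((rest w)%:E * \d_(X j w) B)%E.
    by rewrite (hE psi)// psij EFinM muleC.
  have : (\int[Pr]_w ((history n.+1 psi w)%:E * (\1_A (X n.+1 w))%:E) =
      \int[Pr]_w ((history n.+1 psi w)%:E * P (X n w) A))%E.
    apply: (IH psi (ltnW jn)) => // i.
    + by rewrite /psi; case: ifP.
    + by rewrite /psi; case: ifP.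
    + rewrite /psi; case: eqP => [_ _|/eqP ij ji]; first by exists B.
      by apply: ind; rewrite ltn_neqAle eq_sym ij.
  by congr (_ = _); apply: eq_integral => w _; rewrite hpsi muleAC.
- by move=> z; rewrite lee_fin.
- exact/measurable_EFinP.
Qed.

(** The last replacement: [h] for the indicator at time [n.+1], by comparing the Dirac mass at
    [X n.+1 w] with the kernel [P (X n w)] under the same weight. *)
Lemma markov_step n (phi : nat -> T -> R) (h : T -> R) :
  (forall i z, 0 <= phi i z) -> (forall i, measurable_fun setT (phi i)) ->
  (forall z, 0 <= h z) -> measurable_fun setT h ->
  (\int[Pr]_w ((\prod_(i < n.+1) phi i (X i w))%:E * (h (X n.+1 w))%:E) =
   \int[Pr]_w ((\prod_(i < n.+1) phi i (X i w))%:E * \int[P (X n w)]_z (h z)%:E))%E.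
Proof.
move=> phi0 mphi h0 mh.
have mH : measurable_fun setT (fun w => (history n.+1 phi w)%:E).
  by apply/measurable_EFinP; exact: history_measurable.
have H0 w : (0 <= (history n.+1 phi w)%:E)%E by rewrite lee_fin; exact: history_ge0.
transitivity (mixint Pr (fun w => (history n.+1 phi w)%:E) (fun w => \d_(X n.+1 w)) (EFin \o h)).
  by rewrite mixint_dirac//; exact/measurable_EFinP.
apply: (eq_mixint Pr _ _ Pr (fun w => (history n.+1 phi w)%:E) (fun w => P (X n w))) => //.
- by move=> A mA; apply: measurable_fun_dirac_comp => //; exact: chain_measurable.
- by move=> A mA; apply: (measurableT_comp (HPmeas A mA)); exact: chain_measurable.
- move=> A mA.
  (* Factors beyond [n] do not enter the product; setting them to 1 makes them indicators, as
     [markov_partial] demands. *)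
  pose psi i := if (i <= n)%N then phi i else \1_setT.
  have E w : history n.+1 phi w = history n.+1 psi w.
    by apply: eq_bigr => i _; rewrite /psi -ltnS ltn_ord.
  have : (\int[Pr]_w ((history n.+1 psi w)%:E * (\1_A (X n.+1 w))%:E) =
      \int[Pr]_w ((history n.+1 psi w)%:E * P (X n w) A))%E.
    apply: (markov_partial n.+1 n psi A (leqnn _)) => // i.
    + by rewrite /psi; case: ifP.
    + by rewrite /psi; case: ifP.
    + by rewrite /psi ltnNge => /negbTE ->; exists setT.
  by congr (_ = _); apply: eq_integral => w _; rewrite -E.
- exact/measurable_EFinP.
Qed.

Lemma integral_chain0 (h : T -> R) : measurable ([set x] : set T) ->
  measurable_fun setT h -> (\int[Pr]_w (h (X 0%N w))%:E = (h x)%:E)%E.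
Proof.
move=> mx mh; have [_ [X0 _]] := HX.
have mX0 : measurable (X 0%N @^-1` [set x]).
  by rewrite -[X in measurable X]setTI; exact: chain_measurable.
transitivity (\int[Pr]_w (cst (h x)%:E w))%E; last first.
  by rewrite integral_cst//= [X in (_ * X)%E](probability_setT Pr) mule1.
apply: ae_eq_integral => //.
  by apply/measurable_EFinP; exact: chain_comp_measurable.
exists (~` (X 0%N @^-1` [set x])); split; first exact: measurableC.
  by rewrite [LHS](probability_setC Pr mX0) X0 subee.
by move=> w /= H X0x; apply: H => _; rewrite X0x.
Qed.

Lemma integral_chain_step n (h : T -> R) : (forall z, 0 <= h z) -> measurable_fun setT h ->
  (\int[Pr]_w (h (X n.+1 w))%:E = \int[Pr]_w \int[P (X n w)]_z (h z)%:E)%E.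
Proof.
move=> h0 mh.
have := markov_step n (fun _ _ => 1) h (fun _ _ => ler01) (fun=> measurable_cst _) h0 mh.
by congr (_ = _); apply: eq_integral => w _; rewrite big1// mul1e.
Qed.

End MarkovChain.

(** * Integrability and means along the chain *)

Section ChainMean.
Context {R : realType} {dT : measure_display} {T : measurableType dT}.
Variable dist : T -> T -> R.
Hypothesis Hmetric : is_metric dist.
Hypothesis Hborel : borel_of dist.
Variable P : T -> probability T R.
Hypothesis HPmeas : forall A : set T, measurable A -> measurable_fun setT (fun x => P x A).
Hypothesis HPmom : forall x : T, (\int[P x]_y (dist x y)%:E < +oo)%E.
Variable kappa : R.
Hypotheses (kappa0 : 0 < kappa) (kappa1 : kappa <= 1).
Hypothesis Hcontr : forall x y : T,
  (W1 dist (P x) (P y) <= ((1 - kappa) * dist x y)%:E)%E.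
Context {dO : measure_display} {Omega : measurableType dO}.
Variables (Pr : probability Omega R) (X : nat -> Omega -> T) (x : T).
Hypothesis HX : markov_chain_from P Pr X x.
Local Notation lip := (lip_with dist).

Let lip_dist := lip_with_dist dist Hmetric x.
Let mdist : measurable_fun setT (dist x) := lip_with_measurable dist Hmetric Hborel _ _ lip_dist.
Let dist0 z : 0 <= dist x z := metric_ge0 dist Hmetric x z.
Let mchain n h : measurable_fun setT h -> measurable_fun setT (fun w => h (X n w) : R).
Proof. exact: (chain_comp_measurable P Pr X x HX). Qed.

(** By the drift inequality each step adds at most the constant [averaging P (dist x) x]. *)
Lemma chain_first_moment n : (\int[Pr]_w (dist x (X n w))%:E < +oo)%E.
Proof.
elim: n => [|n IH].
  rewrite (integral_chain0 P Pr X x HX)//; [exact: ltry|exact: (measurable_set1_metric dist)].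
rewrite (integral_chain_step P HPmeas Pr X x HX)//.
have J0 : 0 <= averaging P (dist x) x by exact: averaging_ge0.
apply: le_lt_trans (_ : \int[Pr]_w ((dist x (X n w))%:E + cst (averaging P (dist x) x)%:E w) < +oo)%E.
  apply: ge0_le_integralT => w; first by apply: integral_ge0 => z _; rewrite lee_fin.
  rewrite (integral_kernel_averaging dist Hmetric Hborel P HPmom _ 1)// -EFinD lee_fin.
  apply: le_trans (averaging_dist_le dist Hmetric Hborel P HPmom kappa Hcontr x _) _.
  by rewrite lerD2r ler_piMl// gerBl ltW.
rewrite ge0_integralD//; last 2 first.
- by move=> w _; rewrite lee_fin.
- by apply/measurable_EFinP; exact: mchain.
by rewrite integral_cst//= [X in (_ * X)%E](probability_setT Pr) mule1 lte_add_pinfty// ltry.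
Qed.

Lemma chain_integrable n c h : lip c h -> Pr.-integrable setT (EFin \o (fun w => h (X n w))).
Proof.
move=> hc.
have mh := lip_with_measurable _ Hmetric Hborel _ _ hc.
have id : Pr.-integrable setT (EFin \o (fun w => dist x (X n w))).
  apply/integrableP; split; first by apply/measurable_EFinP; exact: mchain.
  apply: le_lt_trans (chain_first_moment n); apply: ge0_le_integralT => // z.
  by rewrite /= ger0_norm.
apply: (@le_integrable _ _ _ _ setT measurableT _
    ((EFin \o cst `|h x|%R) \+ (fun w => `|c|%R%:E * (EFin \o (fun w => dist x (X n w))) w)))%E.
- by apply/measurable_EFinP; exact: mchain.
- move=> w _; rewrite /= lee_fin [leRHS]ger0_norm; last by rewrite addr_ge0// mulr_ge0.
  have H := hc x (X n w); have := ler_norm c; move: `|c| => c' cc'.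
  have : c * dist x (X n w) <= c' * dist x (X n w) by rewrite ler_wpM2r.
  by have := ler_distD (h x) (h (X n w)) 0; rewrite !subr0 (distrC (h (X n w))); lra.
- apply: integrableD => //; first exact: finite_measure_integrable_cst.
  exact: integrableZl.
Qed.

Let Rintegral_chain_step_ge0 n c h : lip c h -> (forall z, 0 <= h z) ->
  Rintegral Pr setT (fun w => h (X n.+1 w)) = Rintegral Pr setT (fun w => averaging P h (X n w)).
Proof.
move=> hc h0; congr fine.
rewrite (integral_chain_step P HPmeas Pr X x HX)//; last exact: lip_with_measurable hc.
by apply: eq_integral => w _; rewrite (integral_kernel_averaging dist Hmetric Hborel P HPmom _ c).
Qed.

(** The Markov step is available for nonnegative functions only. Adding the Lipschitz function [g],
    which dominates [- h], reduces to that case, applied to [h + g] and to [g]; integrability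
    permits the subtraction. *)
Lemma Rintegral_chain_step n c h : 0 <= c -> lip c h ->
  Rintegral Pr setT (fun w => h (X n.+1 w)) = Rintegral Pr setT (fun w => averaging P h (X n w)).
Proof.
move=> c0 hc.
pose g z := c * dist x z + `|h x|.
have gl : lip c g.
  move=> y z; rewrite /g opprD addrACA subrr addr0.
  by apply: le_trans (lip_withZ _ _ c _ lip_dist y z) _; rewrite (ger0_norm c0) mulr1.
have g0 z : 0 <= g z by rewrite addr_ge0// mulr_ge0.
have hg0 z : 0 <= h z + g z.
  rewrite /g; have /ler_normlP[_ H] := hc x z; have := ler_norm (h x).
  by have := ler_norm (- h x); rewrite normrN; lra.
have hgl : lip (c + c) (fun z => h z + g z) by exact: lip_withD.
have cc : 0 <= c + c by rewrite addr_ge0.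
have := Rintegral_chain_step_ge0 n _ _ hgl hg0.
have A d u : 0 <= d -> lip d u -> lip (d * (1 - kappa)) (averaging P u).
  exact: averaging_lip.
under [in X in _ = X -> _]eq_Rintegral => w _ do
  rewrite (averagingD dist Hmetric Hborel P HPmom c c)//.
rewrite RintegralD//; [|exact: chain_integrable hc|exact: chain_integrable gl].
rewrite RintegralD//; [|exact: (chain_integrable _ _ _ (A _ _ c0 hc))
  |exact: (chain_integrable _ _ _ (A _ _ c0 gl))].
by rewrite (Rintegral_chain_step_ge0 n _ _ gl g0) => /addIr.
Qed.

Variables (S : T -> R) (C : R).
Hypotheses (C0 : 0 <= C) (SC : lip C S).
Variables (f : T -> R) (u : nat -> R).
Hypotheses (f1 : lip 1 f) (u1 : forall n, `|u n| <= 1).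

Lemma Rintegral_chain_sum n :
  Pr.-integrable setT (EFin \o (fun w => \sum_(i < n) u i * f (X i w))) /\
  Rintegral Pr setT (fun w => \sum_(i < n) u i * f (X i w)) =
  \sum_(i < n) u i * Rintegral Pr setT (fun w => f (X i w)).
Proof.
elim: n => [|n [IH1 IH2]].
  have -> : (fun w => \sum_(i < 0) u i * f (X i w)) = (fun=> 0).
    by apply/funext => w; rewrite big_ord0.
  by rewrite big_ord0 Rintegral_cst_probability; split => //; exact: integrable_cst_probability.
have -> : (fun w => \sum_(i < n.+1) u i * f (X i w)) =
    (fun w => \sum_(i < n) u i * f (X i w) + u n * f (X n w)).
  by apply/funext => w; rewrite big_ord_recr.
have i1 := chain_integrable n 1 f f1.
have i2 : Pr.-integrable setT (EFin \o (fun w => u n * f (X n w))).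
  exact: (integrableZl measurableT _ i1).
split; first exact: (integrableD measurableT IH1 i2).
by rewrite RintegralD// IH2 RintegralZl// big_ord_recr.
Qed.

Lemma backward_mean N :
  Rintegral Pr setT (fun w => \sum_(i < N.+1) u i * f (X i w)) = backward P S f u 0 N 0 x.
Proof.
have bl k n : lip (2 / kappa) (backward P S f u 0 k n).
  by apply: (backward_lip dist Hmetric Hborel P HPmom kappa kappa0 kappa1 Hcontr S C SC f u);
    rewrite ?mul0r.
have k0 : 0 <= 2 / kappa by rewrite divr_ge0// ltW.
(* Tower property: the left side depends only on [n + k], so the split may be moved from [k = 0]
   down to [n = 0], where [X 0] equals [x] almost surely. *)
have claim k n : \sum_(i < n) u i * Rintegral Pr setT (fun w => f (X i w)) +
    Rintegral Pr setT (fun w => backward P S f u 0 k n (X n w)) =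
    \sum_(i < (n + k).+1) u i * Rintegral Pr setT (fun w => f (X i w)).
  elim: k n => [|k IH] n /=.
    by rewrite RintegralZl//; [rewrite addn0 big_ord_recr|exact: chain_integrable f1].
  rewrite addnS -addSn -IH big_ord_recr/= -addrA; congr (_ + _).
  have i1 := chain_integrable n 1 f f1.
  rewrite (Rintegral_chain_step n (2 / kappa))//.
  under eq_Rintegral => w _ do rewrite mul0r addr0.
  rewrite RintegralD//; first by rewrite RintegralZl.
  - exact: (integrableZl measurableT _ i1).
  - apply: (chain_integrable n (2 / kappa * (1 - kappa))); exact: averaging_lip.
rewrite (Rintegral_chain_sum N.+1).2.
have := claim N 0%N; rewrite big_ord0 add0r add0n => <-.
rewrite /Rintegral (integral_chain0 P Pr X x HX)//; first exact: (measurable_set1_metric dist).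
exact: lip_with_measurable (bl N 0%N).
Qed.

End ChainMean.

(** * Laplace transform of the weighted sum along the chain *)

Section ChainConcentration.
Context {R : realType} {dT : measure_display} {T : measurableType dT}.
Variable dist : T -> T -> R.
Hypothesis Hmetric : is_metric dist.
Hypothesis Hpolish : is_polish dist.
Hypothesis Hborel : borel_of dist.
Variable P : T -> probability T R.
Hypothesis HPmeas : forall A : set T, measurable A -> measurable_fun setT (fun x => P x A).
Hypothesis HPmom : forall x : T, (\int[P x]_y (dist x y)%:E < +oo)%E.
Variable kappa : R.
Hypotheses (kappa0 : 0 < kappa) (kappa1 : kappa <= 1).
Hypothesis Hcontr : forall x y : T,
  (W1 dist (P x) (P y) <= ((1 - kappa) * dist x y)%:E)%E.
Hypothesis Hsig : (sigma_inf dist P < +oo)%E.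
Variable pi : probability T R.
Hypothesis Hinv : invariant_prob P pi.
Variables (S : T -> R) (C : R).
Hypothesis HS : forall x : T,
  (sigma2 dist P x * (n_loc dist P x * kappa%:E)^-1 <= (S x)%:E)%E.
Local Notation lip := (lip_with dist).
Hypotheses (C0 : 0 <= C) (SC : lip C S).
Local Notation sigma := (fine (sigma_inf dist P)).
Context {dO : measure_display} {Omega : measurableType dO}.
Variables (Pr : probability Omega R) (X : nat -> Omega -> T) (x : T).
Hypothesis HX : markov_chain_from P Pr X x.
Variables (f : T -> R) (u : nat -> R).
Hypotheses (f1 : lip 1 f) (u1 : forall n, `|u n| <= 1).

Section Exponent.
Variable l : R.
Hypotheses (l0 : 0 <= l) (lC : 4 * l * C <= kappa) (lsigma : 6 * l * sigma <= kappa).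
(* the increment [l * a ^+ 2 * kappa * S] of one Laplace step, for the slope [a = 2 / kappa] *)
Local Notation s := (4 * l / kappa).
Local Notation back := (backward P S f u s).

Let s0 : 0 <= s. Proof. by rewrite divr_ge0 ?mulr_ge0// ltW. Qed.
Let sC : s * C <= 1. Proof. by rewrite mulrAC ler_pdivrMr// mul1r. Qed.
Let k0 : 0 < 2 / kappa. Proof. by rewrite divr_gt0. Qed.

Let back_lip k n : lip (2 / kappa) (back k n).
Proof. exact: (backward_lip dist Hmetric Hborel P HPmom kappa kappa0 kappa1 Hcontr S C SC f u). Qed.

Let partial_laplace n (g : T -> R) : \bar R :=
  (\int[Pr]_w ((\prod_(i < n) expR (l * (u i * f (X i w))))%:E * (expR (l * g (X n w)))%:E))%E.

Let partial_laplace_step k n :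
  (partial_laplace n.+1 (back k n.+1) <= partial_laplace n (back k.+1 n))%E.
Proof.
have mf : measurable_fun setT f by exact: lip_with_measurable f1.
have me (g : T -> R) : measurable_fun setT g -> measurable_fun setT (fun z => expR (l * g z) : R).
  by move=> mg; apply: (measurableT_comp (@measurable_expR R)); exact: measurable_funM.
pose phi (i : nat) z := expR (l * (u i * f z)).
have := markov_step P HPmeas Pr X x HX n phi (fun z => expR (l * back k n.+1 z)).
rewrite /partial_laplace => ->; [|by move=> i z; exact: expR_ge0| |by move=> z; exact: expR_ge0|]; last 2 first.
- by move=> i; apply: me; exact: measurable_funM.
- by apply: me; exact: lip_with_measurable (back_lip k n.+1).
apply: ge0_le_integralT => w.
  rewrite mule_ge0//; first by rewrite lee_fin prodr_ge0// => i _; exact: expR_ge0.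
  by apply: integral_ge0 => z _; rewrite lee_fin expR_ge0.
(* The factor of index [n] depends on [X n] alone; with the one-step bound at [X n w] it forms the
   exponential of [l * back k.+1 n]. *)
rewrite big_ord_recr/= EFinM -muleA lee_wpmul2l//.
  by rewrite lee_fin prodr_ge0// => i _; exact: expR_ge0.
rewrite (mulrDr l) expRD EFinM lee_wpmul2l ?lee_fin ?expR_ge0//.
have := kernel_expR_lip_le dist Hmetric Hpolish Hborel P HPmom kappa kappa0 Hsig S HS
  (X n w) (2 / kappa) (back k n.+1) l k0 (back_lip k n.+1) l0.
have -> : l * (2 / kappa) ^+ 2 * kappa = s.
  by field; rewrite gt_eqF.
apply.
rewrite mulrA mulrAC ler_pdivrMr// mul1r; apply: le_trans lsigma.
by rewrite le_eqVlt; apply/orP; left; apply/eqP; ring.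
Qed.

Lemma chain_laplace N :
  (\int[Pr]_w (expR (l * \sum_(i < N.+1) u i * f (X i w)))%:E <=
    (expR (l * back N 0 x))%:E)%E.
Proof.
have Hle k n : (partial_laplace (n + k) (back 0 (n + k)) <= partial_laplace n (back k n))%E.
  elim: k n => [|k IH] n; first by rewrite addn0.
  by apply: le_trans (partial_laplace_step k n); rewrite addnS -addSn; exact: IH.
have := Hle N 0%N; rewrite add0n.
have -> : partial_laplace N (back 0 N) =
    (\int[Pr]_w (expR (l * \sum_(i < N.+1) u i * f (X i w)))%:E)%E.
  apply: eq_integral => w _.
  by rewrite big_ord_recr/= mulrDr expRD EFinM mulr_sumr expR_sum.
have -> // : partial_laplace 0 (back N 0) = (expR (l * back N 0 x))%:E.
rewrite -(integral_chain0 P Pr X x HX (fun z => expR (l * back N 0 z))).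
- by apply: eq_integral => w _; rewrite big_ord0 mul1e.
- exact: (measurable_set1_metric dist).
- apply: (measurableT_comp (@measurable_expR R)); apply: measurable_funM => //.
  exact: lip_with_measurable (back_lip N 0).
Qed.

(** By [backward_mean], the recursion at [s = 0] equals the mean that is subtracted, so only the
    contribution [l * s * green] survives in the exponent. *)
Lemma chain_laplace_centered N (D := fun w => \sum_(i < N.+1) u i * f (X i w)) :
  (\int[Pr]_w (expR (l * (D w - Rintegral Pr setT D)))%:E <=
    (expR (l * s * (N%:R * Rintegral pi setT S + C / kappa * Emean dist pi x)))%:E)%E.
Proof.
set m := Rintegral Pr setT D.
have mD : measurable_fun setT D.
  apply: measurable_sum => i; apply: measurable_funM => //.
  by apply: (chain_comp_measurable P Pr X x HX i f); exact: lip_with_measurable f1.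
have -> : (fun w => (expR (l * (D w - m)))%:E) =
    (fun w => (expR (- (l * m)))%:E * (expR (l * D w))%:E)%E.
  by apply/funext => w; rewrite -EFinM -expRD mulrBr addrC.
rewrite ge0_integralZl//; last first.
  by apply/measurable_EFinP; apply: measurableT_comp => //; exact: measurable_funM.
apply: le_trans (_ : (expR (- (l * m)))%:E * (expR (l * back N 0 x))%:E <= _)%E.
  by rewrite lee_wpmul2l ?lee_fin ?expR_ge0//; exact: chain_laplace.
rewrite -EFinM -expRD lee_fin ler_expR.
rewrite (backward_green dist Hmetric Hborel P HPmom kappa kappa0 kappa1 Hcontr S C C0 SC f u)//.
rewrite /m /D (backward_mean dist Hmetric Hborel P HPmeas HPmom kappa kappa0 kappa1 Hcontr
  Pr X x HX S C SC)//.
set b0 := backward _ _ _ _ 0 N 0 x; set t := s.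
have -> : - (l * b0) + l * (b0 + t * green P S N x) = l * t * green P S N x by ring.
apply: ler_wpM2l; first by rewrite mulr_ge0// s0.
apply: (green_le dist Hmetric Hborel P HPmeas HPmom kappa kappa0 kappa1 Hcontr pi Hinv S C) => //.
exact: (variance_proxy_ge0 dist P kappa).
Qed.

End Exponent.

End ChainConcentration.

(** * From weighted sums to the empirical mean: one-sided tails *)

Section EmpiricalMean.
Context {R : realType} {T Omega : Type}.
Variables (X : nat -> Omega -> T) (Tn T0 : nat).

Lemma pihat_weighted (f : T -> R) w :
  pihat X Tn T0 f w =
  Tn%:R^-1 * \sum_(i < (T0 + Tn).+1) (T0 < i)%N%:R * f (X i w).
Proof.
rewrite /pihat; congr (_ * _).
rewrite -(big_mkord xpredT (fun i => (T0 < i)%N%:R * f (X i w))).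
(* Indices from 0 to [T0] have weight 0; those from [T0 + 1] to [T0 + Tn] are exactly the window of
   [pihat]. *)
rewrite [RHS](big_cat_nat (n := T0.+1))//=; last by rewrite ltnS leq_addr.
rewrite [X in _ = X + _]big_nat [X in _ = X + _]big1 ?add0r; last first.
  by move=> i /andP[_ iT]; rewrite ltnNge -ltnS iT mul0r.
by rewrite !big_nat; apply: eq_bigr => i /andP[iT _]; rewrite iT mul1r.
Qed.

Lemma pihatZ a (f : T -> R) w : pihat X Tn T0 (fun z => a * f z) w = a * pihat X Tn T0 f w.
Proof. by rewrite /pihat -mulr_sumr mulrCA. Qed.

End EmpiricalMean.

Section Tail.
Context {R : realType} {dT : measure_display} {T : measurableType dT}.
Variable dist : T -> T -> R.
Hypothesis Hmetric : is_metric dist.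
Hypothesis Hpolish : is_polish dist.
Hypothesis Hborel : borel_of dist.
Variable P : T -> probability T R.
Hypothesis HPmeas : forall A : set T, measurable A -> measurable_fun setT (fun x => P x A).
Hypothesis HPmom : forall x : T, (\int[P x]_y (dist x y)%:E < +oo)%E.
Variable kappa : R.
Hypotheses (kappa0 : 0 < kappa) (kappa1 : kappa <= 1).
Hypothesis Hcontr : forall x y : T,
  (W1 dist (P x) (P y) <= ((1 - kappa) * dist x y)%:E)%E.
Hypothesis Hsig : (sigma_inf dist P < +oo)%E.
Variable pi : probability T R.
Hypothesis Hinv : invariant_prob P pi.
Variables (S : T -> R) (C : R).
Hypothesis HS : forall x : T,
  (sigma2 dist P x * (n_loc dist P x * kappa%:E)^-1 <= (S x)%:E)%E.
Local Notation lip := (lip_with dist).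
Hypotheses (C0 : 0 <= C) (SC : lip C S).
Context {dO : measure_display} {Omega : measurableType dO}.
Variables (Pr : probability Omega R) (X : nat -> Omega -> T) (x : T).
Hypothesis HX : markov_chain_from P Pr X x.
Variables (Tn T0 : nat).
Hypothesis Tn0 : (0 < Tn)%N.
Local Notation V2 := ((kappa * Tn%:R)^-1 * (1 + T0%:R / Tn%:R) * Rintegral pi setT S
            + C * Emean dist pi x / (kappa ^+ 2 * Tn%:R ^+ 2)).
Local Notation M := (Num.max (2 * C) (3 * fine (sigma_inf dist P))).

Let weight_le1 (i : nat) : `|(T0 < i)%N%:R : R| <= 1.
Proof. by case: ltnP; rewrite /= ?normr1 ?normr0. Qed.

Lemma pihat_integrable (f : T -> R) : lip 1 f ->
  Pr.-integrable setT (EFin \o pihat X Tn T0 f).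
Proof.
move=> f1.
have [iD _] := Rintegral_chain_sum dist Hmetric Hborel P HPmeas HPmom kappa kappa0 Hcontr
  Pr X x HX f (fun i => (T0 < i)%N%:R) f1 (T0 + Tn).+1.
apply: eq_integrable (integrableZl measurableT (Tn%:R^-1) iD) => // w _.
by rewrite /= pihat_weighted.
Qed.

(** Chernoff's bound from the Laplace estimate at [l / Tn]. The two arguments of the maximum supply
    its two side conditions, and the factor [(T0 + Tn) / (kappa Tn^2)] in front of the mean of S is
    the one in [V2]. *)
Lemma pihat_tail (f : T -> R) (l r : R) : lip 1 f -> 0 <= l -> 2 * l * M <= kappa * Tn%:R ->
  (Pr [set w | (r <= pihat X Tn T0 f w - Rintegral Pr setT (pihat X Tn T0 f))%R]
   <= (expR (- (l * r) + 4 * l ^+ 2 * V2))%:E)%E.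
Proof.
move=> f1 l0 lM.
have ipi := pihat_integrable f f1.
have T0R : 0 < Tn%:R :> R by rewrite ltr0n.
set e := Rintegral Pr setT (pihat X Tn T0 f).
set A := [set w | _].
have mp : measurable_fun setT (pihat X Tn T0 f) by case/integrableP: ipi => /measurable_EFinP.
have mA : measurable A.
  rewrite -[A]setTI; apply: measurable_fun_le => //.
  exact: measurable_funB.
have lC2 : 2 * l * (2 * C) <= kappa * Tn%:R.
  by apply: le_trans lM; rewrite ler_wpM2l ?mulr_ge0// le_max lexx.
have ls2 : 2 * l * (3 * fine (sigma_inf dist P)) <= kappa * Tn%:R.
  by apply: le_trans lM; rewrite ler_wpM2l ?mulr_ge0// le_max lexx orbT.
have k1 : 0 <= l / Tn%:R by rewrite divr_ge0// ltW.
have k2 : 4 * (l / Tn%:R) * C <= kappa.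
  rewrite (_ : _ * C = 2 * l * (2 * C) / Tn%:R); first by rewrite ler_pdivrMr.
  by field; rewrite gt_eqF.
have k3 : 6 * (l / Tn%:R) * fine (sigma_inf dist P) <= kappa.
  rewrite (_ : _ * fine _ = 2 * l * (3 * fine (sigma_inf dist P)) / Tn%:R).
    by rewrite ler_pdivrMr.
  by field; rewrite gt_eqF.
pose D w := \sum_(i < (T0 + Tn).+1) (T0 < i)%N%:R * f (X i w).
have : (\int[Pr]_w (expR (l / Tn%:R * (D w - Rintegral Pr setT D)))%:E <=
    (expR (l / Tn%:R * (4 * (l / Tn%:R) / kappa) *
      ((T0 + Tn)%:R * Rintegral pi setT S + C / kappa * Emean dist pi x)))%:E)%E.
  exact: (chain_laplace_centered dist Hmetric Hpolish Hborel P HPmeas HPmom kappa kappa0 kappa1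
    Hcontr Hsig pi Hinv S C HS C0 SC Pr X x HX f (fun i => (T0 < i)%N%:R) f1 weight_le1
    (l / Tn%:R) k1 k2 k3 (T0 + Tn)).
have DE w : D w = Tn%:R * pihat X Tn T0 f w.
  by rewrite pihat_weighted mulrA divff ?mul1r// gt_eqF.
have -> : Rintegral Pr setT D = Tn%:R * e.
  rewrite /e -RintegralZl//; apply: eq_Rintegral => w _; exact: DE.
have -> : (l / Tn%:R) * (4 * (l / Tn%:R) / kappa) *
    ((T0 + Tn)%:R * Rintegral pi setT S + C / kappa * Emean dist pi x) = 4 * l ^+ 2 * V2.
  by rewrite natrD; field; rewrite !gt_eqF.
move=> H.
have -> : Pr A = (\int[Pr]_w (\1_A w)%:E)%E by rewrite integral_indic// setIT.
rewrite expRD EFinM.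
apply: le_trans (_ : (expR (- (l * r)))%:E *
   \int[Pr]_w (expR (l / Tn%:R * (D w - Tn%:R * e)))%:E <= _)%E; last first.
  by rewrite lee_wpmul2l// lee_fin expR_ge0.
have mexp : measurable_fun setT (fun w => expR (l / Tn%:R * (D w - Tn%:R * e))).
  apply: (measurableT_comp (@measurable_expR R)).
  apply: measurable_funM => //; apply: measurable_funB => //.
  by rewrite (_ : D = fun w => Tn%:R * pihat X Tn T0 f w);
    [exact: measurable_funM|exact/funext].
rewrite -ge0_integralZl ?lee_fin ?expR_ge0//; last exact/measurable_EFinP.
apply: ge0_le_integralT => w; first by rewrite lee_fin.
rewrite -EFinM -expRD lee_fin indicE.
have [/set_mem Aw|_] := boolP (w \in A); last by rewrite expR_ge0.
apply: (@le_trans _ _ (expR 0)); first by rewrite expR0.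
rewrite ler_expR (_ : _ + _ = l * (pihat X Tn T0 f w - e - r)).
  by rewrite mulr_ge0// subr_ge0.
by rewrite DE; field; rewrite gt_eqF.
Qed.

End Tail.

(** * Two-sided bound and choice of [l] in the two regimes *)

Theorem theorem5 (R : realType) (dT : measure_display) (T : measurableType dT)
  (dist : T -> T -> R)
  (Hmetric : is_metric dist) (Hpolish : is_polish dist) (Hborel : borel_of dist)
  (P : T -> probability T R)
  (HPmeas : forall A : set T, measurable A -> measurable_fun [set: T] (fun x => P x A))
  (HPmom : forall x : T, (\int[P x]_y (dist x y)%:E < +oo)%E)
  (kappa : R) (Hkappa : 0 < kappa)
  (Hcontr : forall x y : T, (W1 dist (P x) (P y) <= ((1 - kappa) * dist x y)%:E)%E)
  (Hsig : (sigma_inf dist P < +oo)%E)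
  (pi : probability T R) (Hinv : invariant_prob P pi)
  (S : T -> R) (C : R) (HSlip : dlipschitz dist S) (HSC : (dlipnorm dist S <= C%:E)%E)
  (HS : forall x : T, (sigma2 dist P x * (n_loc dist P x * kappa%:E)^-1 <= (S x)%:E)%E)
  (Tn T0 : nat) (HT : (1 <= Tn)%N)
  (f : T -> R) (Hf : dlipschitz dist f) (Hnc : exists y z : T, f y <> f z)
  (x : T)
  (dO : measure_display) (Omega : measurableType dO) (Pr : probability Omega R)
  (X : nat -> Omega -> T) (HX : markov_chain_from P Pr X x)
  (r : R) (Hr : 0 < r) :
  let V2 := (kappa * Tn%:R)^-1 * (1 + T0%:R / Tn%:R) * Rintegral pi setT S
            + C * Emean dist pi x / (kappa ^+ 2 * Tn%:R ^+ 2) in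
  let M := Num.max (2 * C) (3 * fine (sigma_inf dist P)) in
  let rmax := 4 * V2 * kappa * Tn%:R / M in
  let Ex := Rintegral Pr setT (pihat X Tn T0 f) in
  (Pr [set w | (r <= `|pihat X Tn T0 f w - Ex| / fine (dlipnorm dist f))%R]
   <= (if r < rmax then 2 * expR (- (r ^+ 2) / (16 * V2))
       else 2 * expR (- (kappa * Tn%:R * r) / (4 * M)))%:E)%E.
Proof.
cbv zeta.
set V2 := (kappa * Tn%:R)^-1 * _ * _ + _.
set M := Num.max _ _; set rmax := 4 * V2 * kappa * Tn%:R / M.
set Ex := Rintegral Pr _ _.
have [y [z fyz]] := Hnc.
have yz : y <> z by move=> E; apply: fyz; rewrite E.
have d0 u v : 0 <= dist u v by exact: metric_ge0.
have dpos u v : u <> v -> 0 < dist u v.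
  by move=> uv; rewrite lt_neqAle d0 andbT eq_sym; apply/eqP => /(metric_eq0 dist Hmetric).
have lipE g c : (dlipnorm dist g <= c%:E)%E -> lip_with dist c g.
  move=> gc u v; have [->|/eqP uv] := eqVneq u v.
    by rewrite subrr normr0 metric_refl// mulr0.
  rewrite -ler_pdivrMr ?dpos// -lee_fin; apply: le_trans gc.
  by apply: ereal_sup_ubound; exists u, v.
have SC := lipE _ _ HSC.
(* A non-constant [f] provides two distinct points; their positive distance forces [C >= 0], and
   [kappa <= 1] because [W1] is nonnegative. *)
have C0 : 0 <= C.
  by rewrite -(pmulr_lge0 _ (dpos _ _ yz)); apply: le_trans (SC y z).
have kappa1 : kappa <= 1.
  rewrite -subr_ge0 -(pmulr_lge0 _ (dpos _ _ yz)) -lee_fin; apply: le_trans (Hcontr y z).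
  by apply: le_ereal_inf_tmp => _ [g _ <-]; apply: integral_ge0 => t _; rewrite lee_fin.
have Tn0 : (0 < Tn%:R :> R) by rewrite ltr0n.
have M0 : 0 <= M by rewrite le_max mulr_ge0.
have [L0 HL] : 0 < fine (dlipnorm dist f) /\ dlipnorm dist f \is a fin_num.
  have lb : (0 < dlipnorm dist f)%E.
    apply: lt_le_trans (_ : (`|f y - f z| / dist y z)%:E <= _)%E; last first.
      by apply: ereal_sup_ubound; exists y, z.
    by rewrite lte_fin divr_gt0 ?dpos// normr_gt0 subr_eq0; exact/eqP.
  have fl : dlipnorm dist f \is a fin_num.
    rewrite ge0_fin_numE ?ltW//; have [c fc] := Hf.
    apply: le_lt_trans (ltry c); apply: ge_ereal_sup => _ [u [v [uv ->]]].
    by rewrite lee_fin ler_pdivrMr ?dpos.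
  by split=> //; rewrite fine_gt0// lb ltey_eq fl.
set L := fine (dlipnorm dist f) in L0 *.
have fL : lip_with dist L f by apply: lipE; rewrite fineK.
(* Normalised to slope 1, with [a = 1] and [a = -1] for the upper and the lower deviation; the two
   tails account for the factor 2. *)
pose g a t := a * (L^-1 * f t).
have g1 a : `|a| = 1 -> lip_with dist 1 (g a).
  move=> a1 u v; rewrite /g -!mulrBr !normrM a1 !mul1r gtr0_norm ?invr_gt0//.
  by rewrite mulrC ler_pdivrMr// mulrC.
have ipi := pihat_integrable dist Hmetric Hborel P HPmeas HPmom kappa Hkappa Hcontr Pr X x HX Tn T0.
have piE a w : pihat X Tn T0 (g a) w = a * L^-1 * pihat X Tn T0 f w.
  by rewrite /g !pihatZ mulrA.
have RE a : Rintegral Pr setT (pihat X Tn T0 (g a)) = a * L^-1 * Ex.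
  rewrite -RintegralZl//; first by apply: eq_Rintegral => w _; exact: piE.
  have := integrableZl measurableT L (ipi (g 1) (g1 1 (normr1 _))).
  by apply: eq_integrable => // w _; rewrite /= piE mul1r -EFinM mulVKf ?gt_eqF.
have mpi a : `|a| = 1 -> measurable_fun setT (pihat X Tn T0 (g a)).
  by move=> a1; case/integrableP: (ipi _ (g1 a a1)) => /measurable_EFinP.
have two_sided l : 0 <= l -> 2 * l * M <= kappa * Tn%:R ->
  (Pr [set w | (r <= `|pihat X Tn T0 f w - Ex| / L)%R]
    <= (2 * expR (- (l * r) + 4 * l ^+ 2 * V2))%:E)%E.
  move=> l0 lM.
  pose A a := [set w | r <= pihat X Tn T0 (g a) w - Rintegral Pr setT (pihat X Tn T0 (g a))].
  have mA a : `|a| = 1 -> measurable (A a).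
    move=> a1; rewrite -[A a]setTI; apply: measurable_fun_le => //.
    by apply: measurable_funB => //; exact: mpi.
  have tail a : `|a| = 1 -> (Pr (A a) <= (expR (- (l * r) + 4 * l ^+ 2 * V2))%:E)%E.
    by move=> a1; apply: (pihat_tail dist Hmetric Hpolish Hborel P HPmeas HPmom kappa Hkappa
      kappa1 Hcontr Hsig pi Hinv S C HS C0 SC Pr X x HX Tn T0 HT (g a) l r (g1 a a1)).
  have E : [set w | (r <= `|pihat X Tn T0 f w - Ex| / L)%R] = A 1 `|` A (-1).
    have nE w : `|pihat X Tn T0 f w - Ex| / L = `|L^-1 * (pihat X Tn T0 f w - Ex)|.
      by rewrite normrM (gtr0_norm (x := L^-1)) ?invr_gt0// mulrC.
    have dE a w : a * L^-1 * pihat X Tn T0 f w - a * L^-1 * Ex =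
        a * (L^-1 * (pihat X Tn T0 f w - Ex)) by rewrite -mulrBr mulrA.
    apply/seteqP; split=> w; rewrite /A /= !RE !piE !dE nE ler_normr mul1r mulN1r.
      by move=> /orP[]; [left|right].
    by move=> [] ->; rewrite ?orbT.
  rewrite E mulr_natl mulr2n EFinD.
  apply: le_trans (measureU2 _ _ _) _; [exact/mA/normr1|apply: mA; exact: normrN1|].
  by apply: leeD; apply: tail; rewrite ?normrN normr1.
have V20 : 0 <= V2.
  have S0 : 0 <= Rintegral pi setT S.
    by apply: Rintegral_ge0 => t _; exact: (variance_proxy_ge0 dist P kappa).
  have E0 : 0 <= Emean dist pi x by exact: Rintegral_ge0.
  have k0 := ltW Hkappa; have t0 := ltW Tn0.
  apply: addr_ge0; last by rewrite divr_ge0 ?mulr_ge0 ?exprn_ge0.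
  by apply: mulr_ge0 => //; rewrite mulr_ge0 ?invr_ge0 ?mulr_ge0 ?addr_ge0 ?divr_ge0.
(* Division by zero yields zero, so for [M = 0] both [rmax] and the exponent of the second branch
   are 0, and the bound to prove is 2; [l = 0] gives it. *)
have [M00|Mneq] := eqVneq M 0.
  have le2 : (Pr [set w | (r <= `|pihat X Tn T0 f w - Ex| / L)%R] <= 2%:E)%E.
    apply: le_trans (two_sided 0 _ _) _ => //; first by rewrite mulr0 mul0r mulr_ge0 ?ltW.
    by rewrite mul0r expr0n/= mulr0 mul0r oppr0 addr0 expR0 mulr1.
  rewrite /rmax M00 invr0 mulr0 ltNge (ltW Hr)/=.
  by rewrite mulr0 invr0 mulr0 expR0 mulr1.
have Mpos : 0 < M by rewrite lt_neqAle M0 andbT eq_sym.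
case: ltP => rr.
  have V2pos : 0 < V2.
    rewrite lt_neqAle V20 andbT eq_sym; apply/eqP => V2z; move: rr.
    by rewrite /rmax V2z mulr0 !mul0r ltNge (ltW Hr).
  (* This [l] minimises [- l r + 4 l^2 V2]; it is admissible because [2 l M = r M / (4 V2)] and
     [r < rmax]. *)
  have := two_sided (r / (8 * V2)).
  have -> : - (r / (8 * V2) * r) + 4 * (r / (8 * V2)) ^+ 2 * V2 = - r ^+ 2 / (16 * V2).
    by field; rewrite gt_eqF.
  apply; first by rewrite divr_ge0 ?mulr_ge0// ltW.
  rewrite (_ : 2 * _ * M = r * M / (4 * V2)); last by field; rewrite gt_eqF.
  rewrite ler_pdivrMr ?mulr_gt0//; move: rr; rewrite /rmax ltr_pdivlMr// => /ltW.
  by rewrite (_ : kappa * Tn%:R * (4 * V2) = 4 * V2 * kappa * Tn%:R)//; ring.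
(* Beyond [rmax] the largest admissible [l] is taken. The linear term is [- kappa Tn r / (2 M)], and
   [r >= rmax] makes the quadratic term at most half of its absolute value. *)
have := two_sided (kappa * Tn%:R / (2 * M)).
move=> H; apply: le_trans (H _ _) _.
- by rewrite divr_ge0 ?mulr_ge0// ltW.
- by rewrite le_eqVlt; apply/orP; left; apply/eqP; field; rewrite gt_eqF.
rewrite lee_fin ler_pM2l// ler_expR.
move: rr; rewrite /rmax ler_pdivrMr// => rr.
have -> : - (kappa * Tn%:R / (2 * M) * r) + 4 * (kappa * Tn%:R / (2 * M)) ^+ 2 * V2 =
    - (kappa * Tn%:R * r) / (4 * M)
    + kappa * Tn%:R / (4 * M ^+ 2) * (4 * V2 * kappa * Tn%:R - r * M).
  by field; rewrite gt_eqF.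
rewrite gerDl; apply: mulr_ge0_le0; last by rewrite subr_le0.
by rewrite divr_ge0 ?mulr_ge0 ?exprn_ge0// ltW.
Qed.
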